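(* Let $\varphi$ be an Orlicz $N$-function, let $w=(w(i))$ be a weight sequence, and let $F$ be a bounded linear functional on $\lambda^0_{\varphi,w}$ (with the Orlicz norm). Then $F=H+S$, where $H(x)=\sum_{i=1}^\infty x(i)y(i)$ for all $x\in\lambda^0_{\varphi,w}$, for some $y\in\mathfrak m_{\varphi_*,w}$, with $\|H\|=\|y\|_{\mathfrak m_{\varphi_*,w}}$; $S$ is a singular functional, i.e. a bounded linear functional on $\lambda^0_{\varphi,w}$ vanishing on $(\lambda_{\varphi,w})_a$; and $$\|F\|=\inf\Big\{\eta>0:\ p_{\varphi_*,w}\Big(\frac y\eta\Big)+\frac1\eta\|S\|\le1\Big\},$$ where $\|F\|$, $\|H\|$, $\|S\|$ are norms in $(\lambda^0_{\varphi,w})^*$.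
   Context: An Orlicz function is a convex function $\varphi:[0,\infty)\to[0,\infty)$ with $\varphi(0)=0$ and $\varphi(t)>0$ for $t>0$. It is an $N$-function if $\lim_{t\to0}\varphi(t)/t=0$ and $\lim_{t\to\infty}\varphi(t)/t=\infty$. The complementary function is $\varphi_*(v)=\sup\{uv-\varphi(u):u\ge0\}$, $v\ge0$; it is an $N$-function when $\varphi$ is. For a real sequence $x=(x(i))$, $d_x(\lambda)=|\{i\in\mathbb N:|x(i)|>\lambda\}|$ for $\lambda>0$, and its decreasing rearrangement is $x^*(i)=\inf\{\lambda>0:d_x(\lambda)<i\}$. A weight sequence $w=(w(i))$ is positive and decreasing (non-increasing) with $\sum_{i=1}^\infty w(i)=\infty$. Put $\alpha_{\varphi,w}(x)=\sum_{i=1}^\infty\varphi(x^*(i))w(i)$. The Orlicz-Lorentz sequence space is the set of real sequences $x$ with $\alpha_{\varphi,w}(\eta x)<\infty$ for some $\eta>0$; it is denoted $\lambda_{\varphi,w}$ with the Luxemburg norm $\|x\|=\inf\{\epsilon>0:\alpha_{\varphi,w}(x/\epsilon)\le1\}$ and $\lambda^0_{\varphi,w}$ with the (equivalent) Orlicz norm $\|x\|^0=\sup\{\sum_{i}x^*(i)z^*(i)w(i):\alpha_{\varphi_*,w}(z)\le1\}$. The order-continuous subspace $(\lambda_{\varphi,w})_a=(\lambda^0_{\varphi,w})_a$ consists of all $x$ such that $\|x_n\|\downarrow0$ whenever $0\le x_n\le|x|$ and $x_n\downarrow0$ pointwise; it equals $\{x:\alpha_{\varphi,w}(\eta x)<\infty\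 \text{for all}\ \eta>0\}$. For an Orlicz function $\psi$ and a real sequence $h$ put $p_{\psi,w}(h)=\inf\{\sum_{i=1}^\infty\psi(|h(i)|/v(i))\,v(i):\ v\prec w\}$, where $v$ ranges over non-negative sequences and $v\prec w$ means $\sum_{i=1}^nv^*(i)\le\sum_{i=1}^nw(i)$ for all $n\in\mathbb N$; where $v(i)=0$ the summand is $0$ if $h(i)=0$ and $\infty$ if $h(i)\ne0$. $\mathfrak m_{\psi,w}$ is the set of $h$ with $p_{\psi,w}(\eta h)<\infty$ for some $\eta>0$, equipped with the norm $\|h\|_{\mathfrak m_{\psi,w}}=\inf\{\epsilon>0:p_{\psi,w}(h/\epsilon)\le1\}$. *)

(* Defs.v *)
From HB Require Import structures.
From mathcomp Require Import all_boot all_order all_algebra.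
From mathcomp Require Import all_classical all_reals all_analysis.

Set Implicit Arguments.
Unset Strict Implicit.
Unset Printing Implicit Defensive.
Import Order.TTheory GRing.Theory Num.Theory.
Import numFieldNormedType.Exports.

Local Open Scope classical_set_scope.
Local Open Scope ring_scope.

(* Sequences are indexed from 0, so index i stands for the position i + 1.
   Suprema, infima, modulars and norms are taken in \bar R: they may be
   infinite for an arbitrary sequence.  An Orlicz function is a map R -> R of
   which only the restriction to [0, +oo[ matters. *)

Section orlicz_functions.
Context {R : realType}.
Implicit Types phi : R -> R.

Record orlicz_function phi : Prop := OrliczFunction {
  orlicz_convex : convex_function (`[0, +oo[ : set (convex_lmodType R^o)) phi ;
  orlicz_0 : phi 0 = 0 ;
  orlicz_gt0 : forall t : R, 0 < t -> 0 < phi t }.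

Record N_function phi : Prop := NFunction {
  N_orlicz : orlicz_function phi ;
  N_cvg0 : phi t / t @[t --> 0^'+] --> 0 ;
  N_cvgy : phi t / t @[t --> +oo] --> +oo }.

(* The real supremum is genuine when phi is an N-function and 0 <= v: the set
   is then bounded above because phi u / u tends to +oo. *)
Definition complementary phi (v : R) : R :=
  sup [set u * v - phi u | u in [set u | 0 <= u]].

End orlicz_functions.

Section orlicz_lorentz.
Context {R : realType}.
Implicit Types (phi psi : R -> R) (w x y z h v : R^nat).

Record weight_sequence w : Prop := WeightSequence {
  weight_gt0 : forall i, 0 < w i ;
  weight_nonincreasing : nonincreasing_seq w ;
  weight_sum : (\sum_(0 <= i <oo) (w i)%:E = +oo)%E }.

Definition distribution_function x (l : R) : \bar R :=
  counting [set i | l < `|x i|].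

(* +oo at every index when x is unbounded *)
Definition rearrangement x (i : nat) : \bar R :=
  ereal_inf [set l%:E | l in
    [set l | 0 < l /\ (distribution_function x l < i.+1%:R%:E)%E]].

(* er_map extends phi by phi(+oo) = +oo; the value -oo does not occur. *)
Definition modular phi w x : \bar R :=
  (\sum_(0 <= i <oo) er_map phi (rearrangement x i) * (w i)%:E)%E.

Definition orlicz_lorentz phi w : set R^nat :=
  [set x | exists2 eta : R, 0 < eta &
    (modular phi w (fun i => eta * x i)%R < +oo)%E].

Definition luxemburg_norm phi w x : \bar R :=
  ereal_inf [set eps%:E | eps in
    [set eps : R | 0 < eps /\ (modular phi w (fun i => x i / eps)%R <= 1)%E]].

Definition orlicz_norm phi w x : \bar R :=
  ereal_sup [set (\sum_(0 <= i <oo)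
                    rearrangement x i * rearrangement z i * (w i)%:E)%E |
    z in [set z | (modular (complementary phi) w z <= 1)%E]].

Definition order_continuous phi w : set R^nat :=
  [set x | orlicz_lorentz phi w x /\
    forall u : nat -> R^nat,
      (forall n i, 0 <= u n i <= `|x i|) ->
      (forall i, nonincreasing_seq (u ^~ i)) ->
      (forall i, u n i @[n --> \oo] --> 0) ->
      nonincreasing_seq (fun n => luxemburg_norm phi w (u n)) /\
      luxemburg_norm phi w (u n) @[n --> \oo] --> 0%E].

Definition submajorized v w : Prop :=
  forall n, (\sum_(i < n) rearrangement v i <= (\sum_(i < n) w i)%:E)%E.

Definition p_summand psi (a b : R) : \bar R :=
  if b == 0 then (if a == 0 then 0%E else +oo%E) else (psi (`|a| / b) * b)%:E.

Definition p_modular psi w h : \bar R :=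
  ereal_inf [set (\sum_(0 <= i <oo) p_summand psi (h i) (v i))%E |
    v in [set v | (forall i, 0 <= v i) /\ submajorized v w]].

Definition m_space psi w : set R^nat :=
  [set h | exists2 eta : R, 0 < eta &
    (p_modular psi w (fun i => eta * h i)%R < +oo)%E].

Definition m_norm psi w h : \bar R :=
  ereal_inf [set eps%:E | eps in
    [set eps : R | 0 < eps /\ (p_modular psi w (fun i => h i / eps)%R <= 1)%E]].

(* Functionals on the Orlicz-Lorentz space are represented by maps on all
   sequences; their values outside the space are irrelevant. *)
Implicit Types F : R^nat -> R.

Record bounded_functional phi w F : Prop := BoundedFunctional {
  functionalD : forall x y, orlicz_lorentz phi w x -> orlicz_lorentz phi w y ->
    F (fun i => x i + y i) = F x + F y ;
  functionalZ : forall (a : R) x, orlicz_lorentz phi w x ->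
    F (fun i => a * x i) = a * F x ;
  functional_bounded : exists M : R, forall x, orlicz_lorentz phi w x ->
    (`|F x|%:E <= M%:E * orlicz_norm phi w x)%E }.

Definition dual_norm phi w F : \bar R :=
  ereal_sup [set `|F x|%:E | x in
    [set x | orlicz_lorentz phi w x /\ (orlicz_norm phi w x <= 1)%E]].

Definition singular_functional phi w F : Prop :=
  bounded_functional phi w F /\ forall x, order_continuous phi w x -> F x = 0.

End orlicz_lorentz.

(* Main.v *)
(* Write A for the modular of phi and w, and p for the modular of phi_* on the
   dual side. A(x) is the supremum of sum_j phi|x(s_j)| w(j) over finite
   duplicate-free sequences s of indices; hence A is subadditive on disjoint
   supports, and A(x) < oo forces the tails of x to have modular tending to 0.

   By the Amemiya formula ||x||^0 = inf_k (1 + A(kx))/k, where the nontrivial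
   inequality is Lagrange duality for the single constraint A_{phi_*}(z) <= 1,
   a functional G has norm at most eta iff |G x| <= eta (1 + A(x)) whenever
   A(x) < oo. Moreover p is the conjugate of A: Young's inequality and
   Hardy-Littlewood give sum |x y| <= A(x) + p(y), and conversely
   sup_u (sum u|y| - A(u)) >= inf_v sup_u sum (u|y| - phi(u) v) = p(y), by
   compactness of the set of v submajorized by w in the product topology and a
   convex minimax argument. Since w composed with an injection is itself submajorized by w, the
   supremum over v of sum phi(u) v is A(u).

   With y(i) = F(e_i), H(x) = sum x y and S = F - H, the functional S does not
   see finitely supported sequences. Testing F on u + (tail of z), u finitely
   supported and z in the unit ball, separates the two parts:
   ||F|| <= eta iff p(y/eta) + ||S||/eta <= 1. *)
Require Import Defs.
From HB Require Import structures.
From mathcomp Require Import all_boot all_order all_algebra.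
From mathcomp Require Import all_classical all_reals all_analysis.
From mathcomp Require Import ring lra.
Import Order.TTheory GRing.Theory Num.Theory.
Import numFieldNormedType.Exports.
Local Open Scope classical_set_scope.
Local Open Scope ring_scope.

(** * Summation by parts and a finite minimax theorem *)

(** Summation by parts: the partial sums of [d - b] are non-negative and so are the decrements of
    [c], hence [\sum c (d - b)] is a sum of non-negative products. *)
Lemma abel_le (R : realDomainType) (n : nat) (c b d : nat -> R) :
  (forall j, (j < n)%N -> 0 <= c j) ->
  (forall j, (j.+1 < n)%N -> c j.+1 <= c j) ->
  (forall m, (m <= n)%N -> \sum_(j < m) b j <= \sum_(j < m) d j) ->
  \sum_(j < n) c j * b j <= \sum_(j < n) c j * d j.
Proof.
move=> c0 cN bd; rewrite -subr_ge0 -sumrB.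
under eq_bigr do rewrite -mulrBr.
pose D m := \sum_(j < m) (d j - b j).
have D0 m : (m <= n)%N -> 0 <= D m.
  by move=> mn; rewrite /D sumrB subr_ge0 bd.
(* The induction needs the boundary term [c m * D m.+1] as a lower bound; mere non-negativity would
   not propagate. *)
have K m : (m < n)%N -> c m * D m.+1 <= \sum_(j < m.+1) c j * (d j - b j).
  elim: m => [|m IH] mn; first by rewrite /D !big_ord1.
  rewrite big_ord_recr /= {1}/D big_ord_recr /= -/(D m.+1) mulrDr lerD2r.
  apply: le_trans (IH (ltnW mn)).
  by apply: ler_wpM2r; [apply/D0/ltnW | apply: cN].
case: n c0 cN bd D0 K => [|n] c0 cN bd D0 K; first by rewrite big_ord0.
by apply: le_trans (K n (ltnSn n)); rewrite mulr_ge0 ?c0 ?D0.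
Qed.

(** A theorem of the alternative for two functions, giving one scalar multiplier. It serves both the
    finite minimax theorem and the Lagrange multiplier behind the Amemiya formula. *)
Lemma two_convexlike_ge0 (R : realType) (V : Type) (K : set V) (f g : V -> R) :
  (forall a b t, K a -> K b -> 0 <= t <= 1 -> exists c, [/\ K c,
     f c <= t * f a + (1 - t) * f b & g c <= t * g a + (1 - t) * g b]) ->
  (forall v, K v -> 0 <= f v \/ 0 <= g v) ->
  exists t, 0 <= t <= 1 /\ forall v, K v -> 0 <= t * f v + (1 - t) * g v.
Proof.
move=> mix fg.
have [[a0 [Ka0 fa0]]|nA] := pselect (exists a, K a /\ f a < 0); last first.
  exists 1; split; first by rewrite ler01 lexx.
  move=> v Kv; rewrite mul1r subrr mul0r addr0 leNgt; apply/negP => fv.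
  by apply: nA; exists v.
have ga a : K a -> f a < 0 -> 0 <= g a by move=> Ka fa; case: (fg a Ka) => //; lra.
have fb b : K b -> g b < 0 -> 0 <= f b by move=> Kb gb; case: (fg b Kb) => //; lra.
have key a b : K a -> K b -> f a < 0 -> g b < 0 -> g b * f a <= g a * f b.
  move=> Ka Kb fa gb; rewrite leNgt; apply/negP => lt.
  have Ga := ga _ Ka fa; have Fb := fb _ Kb gb.
  pose den := (f b - f a) + (g a - g b).
  have den0 : 0 < den by rewrite /den; lra.
  (* At this weight the two mixed bounds coincide. If the claim failed, their common value would be
     negative, and the mixture [c] would make both functions negative. *)
  pose t := (f b - g b) / den.
  have t01 : 0 <= t <= 1.
    apply/andP; split; first by apply: divr_ge0; lra.
    by rewrite ler_pdivrMr // mul1r /den; lra.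
  have tE : t * den = f b - g b by rewrite /t divfK // gt_eqF.
  have fE : (t * f a + (1 - t) * f b) * den = g a * f b - g b * f a.
    have -> : (t * f a + (1 - t) * f b) * den = (t * den) * (f a - f b) + f b * den by ring.
    by rewrite tE /den; ring.
  have gE : (t * g a + (1 - t) * g b) * den = g a * f b - g b * f a.
    have -> : (t * g a + (1 - t) * g b) * den = (t * den) * (g a - g b) + g b * den by ring.
    by rewrite tE /den; ring.
  have neg x : x * den = g a * f b - g b * f a -> x < 0.
    by move=> xE; rewrite -(pmulr_llt0 _ den0) xE; lra.
  have [c [Kc fc gc]] := mix a b t Ka Kb t01.
  by case: (fg c Kc) => h; [have := neg _ fE|have := neg _ gE]; lra.
have fb0 b : K b -> g b < 0 -> 0 < f b.
  move=> Kb gb; rewrite lt_neqAle fb // andbT eq_sym; apply/eqP => f0.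
  by have := key _ _ Ka0 Kb fa0 gb; rewrite f0 mulr0 leNgt nmulr_rgt0 // fa0.
(* A multiplier [r] with [r * f + g >= 0] must dominate [- g / f] where [g < 0] and stay below
   [g / - f] where [f < 0]; [key] says that these bounds are compatible. If [A] is empty, its
   supremum is 0 by convention. *)
pose A := [set - g b / f b | b in [set b | K b /\ g b < 0]].
pose r := Num.max 0 (sup A).
have ubA a : K a -> f a < 0 -> ubound A (g a / - f a).
  move=> Ka fa _ [b [Kb gb] <-].
  rewrite ler_pdivrMr ?fb0 // mulrAC ler_pdivlMr; last by lra.
  by rewrite mulrNN key.
have r0 : 0 <= r by rewrite /r le_max lexx.
have rP v : K v -> 0 <= r * f v + g v.
  move=> Kv; have [fv|fv] := ltP (f v) 0.
    have : r <= g v / - f v.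
      rewrite /r ge_max divr_ge0 ?ga //=; last by lra.
      have [A0|/set0P/negP/negPn/eqP->] := pselect (A !=set0).
        by apply: ge_sup => //; apply: ubA.
      by rewrite sup0 divr_ge0 ?ga //; lra.
    by rewrite ler_pdivlMr; lra.
  have [gv|gv] := ltP (g v) 0; last by rewrite addr_ge0 ?mulr_ge0.
  have : - g v / f v <= r.
    rewrite /r le_max; apply/orP; right; apply: ub_le_sup; last by exists v.
    by exists (g a0 / - f a0); apply: ubA.
  by rewrite ler_pdivrMr ?fb0 //; lra.
have r1 : 0 < 1 + r by lra.
exists (r / (1 + r)); split.
  by rewrite divr_ge0 ?(ltW r1) //= ler_pdivrMr // mul1r; lra.
move=> v Kv.
have -> : r / (1 + r) * f v + (1 - r / (1 + r)) * g v = (r * f v + g v) / (1 + r).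
  by field; apply: lt0r_neq0.
by rewrite divr_ge0 ?rP // ltW.
Qed.

Section minimax.
Context {R : realType} {V : lmodType R}.

Definition cvx_set (K : set V) := forall a b t, K a -> K b -> 0 <= t <= 1 ->
  K (t *: a + (1 - t) *: b).

Definition cvx_on (K : set V) (f : V -> R) := forall a b t, K a -> K b ->
  0 <= t <= 1 -> f (t *: a + (1 - t) *: b) <= t * f a + (1 - t) * f b.

(** Induction on the finite family. Where [f u1] is negative the rest of the family suffices, so one
    [u2] works there; the alternative for [f u1] and [f u2] then gives a convex combination, which
    [mix] replaces by a single member of [P]. *)
Lemma finite_minimax (I : eqType) (P : set I) (f : I -> V -> R) (K0 : set V)
    (u0 : I) :
  P u0 -> (forall u, P u -> cvx_on K0 (f u)) ->
  (forall u1 u2 t, P u1 -> P u2 -> 0 <= t <= 1 -> exists2 u, P u &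
     forall v, K0 v -> t * f u1 v + (1 - t) * f u2 v <= f u v) ->
  forall (s : seq I) (K : set V), K `<=` K0 -> cvx_set K ->
  {in s, forall u, P u} ->
  (forall v, K v -> exists2 u, u \in s & 0 <= f u v) ->
  exists2 u, P u & forall v, K v -> 0 <= f u v.
Proof.
move=> Pu0 cf mix; elim=> [|u1 s IH] K KK0 cK Ps sK.
  by exists u0 => // v /sK[].
have Pu1 : P u1 by apply: Ps; rewrite mem_head.
(* A strict sublevel set of a convex function, hence again convex. *)
pose K' := K `&` [set v | f u1 v < 0].
have [u2 Pu2 u2K] : exists2 u, P u & forall v, K' v -> 0 <= f u v.
  apply: (IH K').
  - by move=> v [/KK0].
  - move=> a b t [Ka fa] [Kb fb] t01; split; first exact: cK.
    apply: (le_lt_trans (cf _ Pu1 a b t (KK0 _ Ka) (KK0 _ Kb) t01)).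
    move: fa fb t01 => /= fa fb /andP[t0 t1].
    by have [->|t0'] := eqVneq t 0; [lra|nra].
  - by move=> u us; apply: Ps; rewrite in_cons us orbT.
  - move=> v [Kv fv]; have [u] := sK v Kv; rewrite in_cons => /orP[/eqP->|us] fu0.
      by move: fv => /=; lra.
    by exists u.
have sub g : cvx_on K0 g -> cvx_on K g.
  by move=> cg a b t Ka Kb; apply: cg; apply: KK0.
have [||t [t01 tK]] := @two_convexlike_ge0 R V K (f u1) (f u2).
- move=> a b t Ka Kb t01; exists (t *: a + (1 - t) *: b); split; first exact: cK.
    exact: (sub _ (cf _ Pu1)).
  exact: (sub _ (cf _ Pu2)).
- move=> v Kv; have [|f1] := leP 0 (f u1 v); [by left|right].
  by apply: u2K.
have [u Pu uK] := mix u1 u2 t Pu1 Pu2 t01.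
by exists u => // v Kv; apply: le_trans (tK v Kv) (uK v (KK0 _ Kv)).
Qed.

End minimax.

(** * Orlicz functions and Young's inequality *)

Section orlicz_theory.
Context {R : realType} {phi : R -> R}.
Hypothesis ophi : orlicz_function phi.

Lemma orlicz_cvx (x y t : R) : 0 <= x -> 0 <= y -> 0 <= t <= 1 ->
  phi (t * x + (1 - t) * y) <= t * phi x + (1 - t) * phi y.
Proof.
move=> x0 y0 t01; have xI : x \in ([set` `[0, +oo[] : set R) by rewrite inE /= in_itv /= x0.
have yI : y \in ([set` `[0, +oo[] : set R) by rewrite inE /= in_itv /= y0.
by have := @orlicz_convex _ _ ophi (Itv01 (proj1 (andP t01)) (proj2 (andP t01))) x y xI yI.
Qed.

Lemma orlicz_ge0 (t : R) : 0 <= t -> 0 <= phi t.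
Proof. by rewrite le_eqVlt => /orP[/eqP<-|/(orlicz_gt0 ophi)/ltW//]; rewrite (orlicz_0 ophi). Qed.

(** Chord slopes of a convex function increase; the product form also covers coinciding points. *)
Lemma orlicz_slope (x y z : R) : 0 <= x -> x <= y -> y <= z ->
  (phi y - phi x) * (z - y) <= (phi z - phi y) * (y - x).
Proof.
move=> x0 xy yz; have [xz|xz] := eqVneq x z.
  have -> : y = x by lra.
  by rewrite -xz !subrr !mul0r.
have d0 : 0 < z - x by lra.
pose t := (z - y) / (z - x).
have tE : t * (z - x) = z - y by rewrite /t divfK // gt_eqF.
have t01 : 0 <= t <= 1.
  apply/andP; split; first by apply: divr_ge0; lra.
  by rewrite ler_pdivrMr // mul1r; lra.
have := orlicz_cvx x z t x0 (le_trans x0 (le_trans xy yz)) t01.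
have -> : t * x + (1 - t) * z = y by nra.
rewrite -(ler_pM2r d0).
have -> : (t * phi x + (1 - t) * phi z) * (z - x) =
    (t * (z - x)) * (phi x - phi z) + phi z * (z - x) by ring.
by rewrite tE; nra.
Qed.

Lemma orlicz_nondecreasing (x y : R) : 0 <= x -> x <= y -> phi x <= phi y.
Proof.
move=> x0; rewrite le_eqVlt => /orP[/eqP->//|xy].
have := @orlicz_slope 0 x y (lexx _) x0 (ltW xy).
rewrite (orlicz_0 ophi) !subr0 => h.
have := @orlicz_ge0 x x0 => p0.
have : 0 <= (phi y - phi x) * x by apply: le_trans h; rewrite mulr_ge0 ?subr_ge0 // ltW.
have [x00|xn] := eqVneq x 0; first by rewrite x00 (orlicz_0 ophi) orlicz_ge0 // -x00 ltW.
by rewrite pmulr_lge0 ?subr_ge0 // lt_def xn.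
Qed.

(** The chord over [[t * a, a]] is no steeper than the one over [[a, 2 * a]]. This quantitative left
    continuity handles rearrangement values that are approached but not attained. *)
Lemma orlicz_shrink (a t : R) : 0 <= a -> 0 <= t <= 1 ->
  phi a - (1 - t) * (phi (2 * a) - phi a) <= phi (t * a).
Proof.
move=> a0 /andP[t0 t1]; have [->|an] := eqVneq a 0; first by rewrite !mulr0 !(orlicz_0 ophi); lra.
have ag : 0 < a by rewrite lt_def an.
have := @orlicz_slope (t * a) a (2 * a).
rewrite mulr_ge0 // ler_piMl //; have -> : a <= 2 * a by lra.
move=> /(_ isT isT isT); have -> : 2 * a - a = a by ring.
have -> : a - t * a = (1 - t) * a by ring.
by rewrite mulrA ler_pM2r //; lra.
Qed.

End orlicz_theory.

(** * The complementary function and equality in Young's inequality *)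

Section complementary_theory.
Context {R : realType} {phi : R -> R}.
Hypothesis nphi : N_function phi.
Let oph := N_orlicz nphi.
Local Notation psi := (complementary phi).

(** By superlinear growth [u * v - phi u] is at most 0 for [u] beyond some [N]; below [N] it is at
    most [N * |v|]. *)
Lemma complementary_ubound (v : R) : has_ubound [set u * v - phi u | u in [set u | 0 <= u]].
Proof.
have /cvgryPge/(_ v)[M [Mr Mv]] := N_cvgy nphi.
pose N := Num.max 1 (M + 1).
have N0 : 0 < N by rewrite /N lt_max ltr01.
exists (N * `|v|) => _ /= [u u0 <-].
have [uN|Nu] := leP u N.
  have := orlicz_ge0 oph _ u0 => p0.
  have : u * v <= N * `|v|; last by lra.
  by apply: le_trans (ler_wpM2l u0 (ler_norm v)) _; apply: ler_wpM2r.
have Mu : M < u by apply: le_lt_trans Nu; rewrite /N le_max; apply/orP; right; lra.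
have := Mv u Mu; rewrite ler_pdivlMr; last exact: lt_trans Nu.
have : 0 <= N * `|v| by rewrite mulr_ge0 // ltW.
lra.
Qed.

Lemma young (u v : R) : 0 <= u -> u * v <= phi u + psi v.
Proof.
move=> u0; rewrite addrC -lerBlDr; apply: ub_le_sup; first exact: complementary_ubound.
by exists u.
Qed.

Lemma complementary_le (v c : R) : (forall u, 0 <= u -> u * v - phi u <= c) -> psi v <= c.
Proof.
move=> h; apply: ge_sup; last by move=> _ [u u0 <-]; apply: h.
by exists (0 * v - phi 0); exists 0 => /=.
Qed.

Lemma complementary_ge0 (v : R) : 0 <= psi v.
Proof. by have := young 0 v (lexx _); rewrite (orlicz_0 oph) add0r mul0r. Qed.

Lemma complementary0 : psi 0 = 0.
Proof.
apply/eqP; rewrite eq_le complementary_ge0 andbT; apply: complementary_le => u u0.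
by rewrite mulr0 sub0r oppr_le0 (orlicz_ge0 oph).
Qed.

Lemma complementary_cvx (x y t : R) : 0 <= t <= 1 ->
  psi (t * x + (1 - t) * y) <= t * psi x + (1 - t) * psi y.
Proof.
move=> /andP[t0 t1]; apply: complementary_le => u u0.
have hx := young u x u0; have hy := young u y u0.
have := ler_wpM2l t0 hx.
have : 0 <= 1 - t by rewrite subr_ge0.
by move=> /ler_wpM2l /(_ _ _ hy); lra.
Qed.

(* Being monotone in [u], the right slope maps a decreasing sequence to a
   decreasing sequence of equality cases in Young's inequality. *)
Definition right_slope (u : R) : R := inf [set (phi t - phi u) / (t - u) | t in [set t | u < t]].

Lemma right_slope_lb (u t : R) : 0 <= u -> u < t -> right_slope u <= (phi t - phi u) / (t - u).
Proof.
move=> u0 ut; apply: ge_inf; last by exists t.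
exists 0 => _ /= [s us <-]; rewrite divr_ge0 // subr_ge0; last exact: ltW.
by apply: (orlicz_nondecreasing oph) => //; apply: ltW.
Qed.

Lemma right_slope_glb (u c : R) : (forall t, u < t -> c <= (phi t - phi u) / (t - u)) ->
  c <= right_slope u.
Proof.
move=> h; apply: lb_le_inf; last by move=> _ [t ut <-]; apply: h.
by exists ((phi (u + 1) - phi u) / (u + 1 - u)); exists (u + 1) => //=; rewrite ltrDl ltr01.
Qed.

Lemma right_slope_ge0 (u : R) : 0 <= u -> 0 <= right_slope u.
Proof.
move=> u0; apply: right_slope_glb => t ut.
rewrite divr_ge0 // subr_ge0; last exact: ltW.
by apply: (orlicz_nondecreasing oph) => //; apply: ltW.
Qed.

Lemma right_slope_nondecreasing (u t : R) : 0 <= u -> u <= t -> right_slope u <= right_slope t.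
Proof.
move=> u0; rewrite le_eqVlt => /orP[/eqP->//|ut].
apply: le_trans (right_slope_lb _ _ u0 ut) _; apply: right_slope_glb => s ts.
rewrite ler_pdivrMr ?subr_gt0 // mulrAC ler_pdivlMr ?subr_gt0 //.
by apply: (orlicz_slope oph) => //; apply: ltW.
Qed.

(** The right slope is a subgradient at [u]: chords to the right are at least as steep, chords to
    the left at most as steep. *)
Lemma right_slope_young (u : R) : 0 <= u ->
  u * right_slope u = phi u + psi (right_slope u).
Proof.
move=> u0; apply/eqP; rewrite eq_le young //= -lerBrDl.
apply: complementary_le => t t0.
have [ut|tu|->//] := ltgtP u t.
  have := right_slope_lb _ _ u0 ut; rewrite ler_pdivlMr ?subr_gt0 //; lra.
have : (phi u - phi t) / (u - t) <= right_slope u.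
  apply: right_slope_glb => s us.
  rewrite ler_pdivrMr ?subr_gt0 // mulrAC ler_pdivlMr ?subr_gt0 //.
  by apply: (orlicz_slope oph) => //; apply: ltW.
rewrite ler_pdivrMr ?subr_gt0 //; lra.
Qed.

End complementary_theory.

(** * Decreasing rearrangements and the modular *)

Section rearrangement_theory.
Context {R : realType}.
Implicit Types (x z : nat -> R) (s : seq nat) (n : nat).

(** Trades the counting measure, infinite sets included, for finite lists of distinct indices, the
    form in which rearrangements are handled from here on. *)
Lemma distribution_function_ltP x (l : R) n :
  (distribution_function x l < n.+1%:R%:E)%E <->
  ~ exists s, [/\ uniq s, size s = n.+1 & {in s, forall k, l < `|x k|}].
Proof.
rewrite /distribution_function /counting; case: ifPn => [/asboolP fA|/asboolPn iA].
  rewrite lte_fin ltr_nat; split.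
    move=> lt [s [us ss sl]]; move: lt; rewrite -ss ltnNge => /negP; apply.
    apply: uniq_leq_size => // k ks.
    rewrite (in_fset_set fA k); exact/mem_set/sl.
  move=> ns; rewrite ltnNge; apply/negP => lt; apply: ns.
  set e := finmap.enum_fset _ in lt.
  exists (take n.+1 e); split.
  - by apply: take_uniq; apply: finmap.fset_uniq.
  - by rewrite size_takel.
  - move=> k /mem_take ke; have := in_fset_set fA k.
    by rewrite ke => /esym /set_mem.
split => // ns; exfalso; apply: ns.
have [B Bl nB] := infinite_set_fset n.+1 iA.
exists (take n.+1 (finmap.enum_fset B)); split.
- by apply: take_uniq; apply: finmap.fset_uniq.
- by rewrite size_takel.
- by move=> k /mem_take ke; apply: Bl.
Qed.

Lemma rearrangement_ge0 x n : (0 <= rearrangement x n)%E.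
Proof. by apply: le_ereal_inf_tmp => _ [l [l0 _] <-]; rewrite lee_fin ltW. Qed.

Lemma rearrangement_nonincreasing x m n : (m <= n)%N ->
  (rearrangement x n <= rearrangement x m)%E.
Proof.
move=> mn; apply: le_ereal_inf => _ [l [l0 dl] <-]; exists l => //; split => //.
by apply: lt_le_trans dl _; rewrite lee_fin ler_nat ltnS.
Qed.

Lemma rearrangement_ge x s (c : R) n : uniq s -> size s = n.+1 ->
  {in s, forall k, c <= `|x k|} -> (c%:E <= rearrangement x n)%E.
Proof.
move=> us ss sc; apply: le_ereal_inf_tmp => _ [l [l0 /distribution_function_ltP dl] <-].
rewrite lee_fin leNgt; apply/negP => lc; apply: dl; exists s; split => // k ks.
exact: lt_le_trans lc (sc k ks).
Qed.

Lemma rearrangement_gt x (c : R) n : 0 < c -> (c%:E < rearrangement x n)%E ->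
  exists s, [/\ uniq s, size s = n.+1 & {in s, forall k, c < `|x k|}].
Proof.
move=> c0 ltc; apply: contrapT => ns; move: ltc; rewrite ltNge => /negP; apply.
by apply: ereal_inf_lbound; exists c => //; split => //; apply/distribution_function_ltP.
Qed.

Lemma exists_notin s : exists k : nat, k \notin s.
Proof.
exists (\max_(k <- s) k).+1; apply/negP => h.
by have := @leq_bigmax_seq _ s xpredT id _ h isT; rewrite /= ltnn.
Qed.

(** At step [n], more than [n] indices have values above [c n] while only [n] are taken, so a fresh
    one remains. Where [c n = 0] any fresh index will do. *)
Lemma greedy_rearrangement x (c : nat -> R) :
  (forall i, c i = 0 \/ 0 < c i /\ ((c i)%:E < rearrangement x i)%E) ->
  forall n, exists s, [/\ uniq s, size s = n &
    forall i, (i < n)%N -> c i <= `|x (nth 0%N s i)|].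
Proof.
move=> hc; elim=> [|n [s [us ss sc]]]; first by exists [::].
have [k ks ck] : exists2 k, k \notin s & c n <= `|x k|.
  have [->|[c0 /(rearrangement_gt _ _ _ c0)[t [ut st tc]]]] := hc n.
    by have [k ks] := exists_notin s; exists k.
  apply: contrapT => nk; have : (size t <= size s)%N.
    apply: uniq_leq_size => // k kt; apply: contrapT => /negP ks.
    by apply: nk; exists k => //; apply/ltW/tc.
  by rewrite st ss ltnn.
exists (rcons s k); split; first by rewrite rcons_uniq ks.
  by rewrite size_rcons ss.
move=> i; rewrite ltnS leq_eqVlt nth_rcons ss => /orP[/eqP->|lin].
  by rewrite ltnn eqxx.
by rewrite lin; apply: sc.
Qed.

Lemma sort_decreasing (g : nat -> R) s : exists2 s', perm_eq s' s &
  forall i j, (i <= j < size s')%N -> g (nth 0%N s' j) <= g (nth 0%N s' i).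
Proof.
pose r : rel nat := fun i j => g j <= g i.
have tr : total r by move=> i j; rewrite /r le_total.
exists (sort r s); first by rewrite perm_sort.
move=> i j /andP[ij js]; apply: (@sorted_leq_nth _ r) => //.
- by move=> a b d; rewrite /r => h1 h2; apply: le_trans h2 h1.
- by move=> a; rewrite /r.
- exact: sort_sorted.
- by rewrite inE (leq_ltn_trans ij).
Qed.

(** Sort by decreasing absolute value: the first [j.+1] entries then all dominate the entry at
    position [j]. *)
Lemma sorted_le_rearrangement x s : uniq s -> exists2 s', perm_eq s' s &
  forall j, (j < size s)%N -> (`|x (nth 0%N s' j)|%:E <= rearrangement x j)%E.
Proof.
move=> us; have [s' ps' ds'] := sort_decreasing (fun k => `|x k|) s.
exists s' => // j js; have js' : (j < size s')%N by rewrite (perm_size ps').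
apply: (@rearrangement_ge x (take j.+1 s')).
- by apply: take_uniq; rewrite (perm_uniq ps').
- by rewrite size_takel.
- move=> k /(nthP 0%N)[i]; rewrite size_takel // ltnS => ij <-.
  by rewrite nth_take //; apply: ds'; rewrite ij.
Qed.

Lemma rearrangementZ x (k : R) n : 0 < k ->
  rearrangement (fun i => k * x i) n = (k%:E * rearrangement x n)%E.
Proof.
(* One inequality for every positive factor suffices: the converse is the same inequality with
   factor [k^-1]. *)
have le (y : nat -> R) (a : R) : 0 < a ->
    (rearrangement (fun i => (a * y i)%R) n <= a%:E * rearrangement y n)%E.
  move=> a0; rewrite -lee_pdivrMl //; apply: le_ereal_inf_tmp => _ [l [l0 dl] <-].
  rewrite lee_pdivrMl // -EFinM; apply: ereal_inf_lbound; exists (a * l) => //.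
  split; first exact: mulr_gt0.
  suff -> : distribution_function (fun i => a * y i) (a * l) = distribution_function y l by [].
  by congr counting; apply/seteqP; split => i /=; rewrite normrM gtr0_norm // ltr_pM2l.
move=> k0; apply/eqP; rewrite eq_le le //=.
rewrite -lee_pdivlMl //; have := le (fun i => k * x i) k^-1; rewrite invr_gt0 => /(_ k0).
by under eq_fun do rewrite mulKf ?gt_eqF //.
Qed.

Lemma rearrangement_decreasing z : (forall i, 0 <= z i) -> nonincreasing_seq z ->
  forall n, rearrangement z n = (z n)%:E.
Proof.
move=> z0 zd n; apply/eqP; rewrite eq_le; apply/andP; split; last first.
  apply: (@rearrangement_ge z (iota 0 n.+1)); [exact: iota_uniq|exact: size_iota|].
  move=> k; rewrite mem_iota /= add0n ltnS => kn.
  by rewrite ger0_norm //; apply: zd.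
apply/lee_addgt0Pr => e e0; rewrite leNgt; apply/negP.
move=> /(rearrangement_gt _ _ _ (ltr_wpDl (z0 n) e0))[s [us ss sc]].
suff : (size s <= size (iota 0 n))%N by rewrite ss size_iota ltnn.
apply: uniq_leq_size => // k /sc; rewrite ger0_norm // mem_iota /= add0n ltnNge.
by move=> h; apply/negP => nk; have := zd _ _ nk; lra.
Qed.

Lemma rearrangement_fin x : (rearrangement x 0 < +oo)%E ->
  forall n, rearrangement x n = (fine (rearrangement x n))%:E.
Proof.
move=> x0 n; rewrite fineK // ge0_fin_numE ?rearrangement_ge0 //.
by apply: le_lt_trans x0; apply: rearrangement_nonincreasing.
Qed.

Lemma rearrangement0_le x (M : R) : (forall i, `|x i| <= M) -> (rearrangement x 0 <= M%:E)%E.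
Proof.
move=> xM; rewrite leNgt; apply/negP.
move=> lt; have [e e0 elt] : exists2 e, M < e & (e%:E < rearrangement x 0)%E.
  case: (rearrangement x 0) lt => [r||//]; rewrite ?lte_fin => lt.
    by exists ((M + r) / 2); rewrite ?lte_fin ?midf_lt.
  by exists (M + 1); [rewrite ltrDl|rewrite ltry].
have e1 : 0 < e by apply: le_lt_trans e0; apply: le_trans (xM 0%N).
have [[|k s] [_ //= _ sc]] := rearrangement_gt _ _ _ e1 elt.
by have := sc k (mem_head _ _); have := xM k; lra.
Qed.

End rearrangement_theory.

(** * The modular as a supremum of finite sums over lists of distinct indices *)

Section arrangement_sums.
Context {R : realType}.
Implicit Types (phi : R -> R) (w x v : nat -> R) (s : seq nat).

(** The weight depends on the position in [s], not on the index stored there. *)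
Definition arrangement_sum phi w x s : R :=
  \sum_(j < size s) phi `|x (nth 0%N s j)| * w j.

(** As [w] decreases, summation by parts reduces the claim to unweighted partial sums, whose terms
    may be reordered freely and hence sorted. *)
Lemma arrangement_sum_le phi w x (a : nat -> R) s : orlicz_function phi ->
  (forall i, 0 <= w i) -> nonincreasing_seq w -> uniq s ->
  (forall i, rearrangement x i = (a i)%:E) ->
  arrangement_sum phi w x s <= \sum_(j < size s) phi (a j) * w j.
Proof.
move=> ophi w0 wd us xa; rewrite /arrangement_sum.
under eq_bigr do rewrite mulrC; under [leRHS]eq_bigr do rewrite mulrC.
apply: (@abel_le _ (size s) w (fun j => phi `|x (nth 0%N s j)|) (fun j => phi (a j))) => //.
  by move=> j _; apply: wd.
move=> m ms; pose t := take m s.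
have ut : uniq t by apply: take_uniq.
have st : size t = m by rewrite size_takel.
have [t' pt' ht'] := sorted_le_rearrangement x t ut.
have st' : size t' = m by rewrite (perm_size pt').
have -> : \sum_(j < m) phi `|x (nth 0%N s j)| = \sum_(k <- t) phi `|x k|.
  rewrite (big_nth 0%N) big_mkord st; apply: eq_bigr => j _.
  by rewrite nth_take.
rewrite -(perm_big _ pt') (big_nth 0%N) big_mkord st'.
apply: ler_sum => j _; apply: (orlicz_nondecreasing ophi) => //.
by rewrite -lee_fin -xa; apply: ht'; rewrite st.
Qed.

Lemma arrangement_cat phi w x s t : arrangement_sum phi w x (s ++ t) =
  arrangement_sum phi w x s + \sum_(j < size t) phi `|x (nth 0%N t j)| * w (size s + j)%N.
Proof.
rewrite /arrangement_sum size_cat big_split_ord /=; congr (_ + _).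
  by apply: eq_bigr => j _; rewrite nth_cat ltn_ord.
by apply: eq_bigr => j _; rewrite nth_cat ltnNge leq_addr addKn.
Qed.

(** The rearrangement need not be attained, but for [t < 1] the values [t * a j] are reached along
    some list of distinct indices. The loss is at most [(1 - t) * C], and [t] tends to 1. *)
Lemma rearrangement_sum_le phi w x (a : nat -> R) (b : R) n : orlicz_function phi ->
  (forall i, 0 <= w i) -> (forall i, rearrangement x i = (a i)%:E) ->
  (forall s, uniq s -> size s = n -> arrangement_sum phi w x s <= b) ->
  \sum_(j < n) phi (a j) * w j <= b.
Proof.
move=> ophi w0 xa hs.
have a0 i : 0 <= a i by rewrite -lee_fin -xa rearrangement_ge0.
pose C := \sum_(j < n) (phi (2 * a j) - phi (a j)) * w j.
have C0 : 0 <= C.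
  apply: sumr_ge0 => j _; rewrite mulr_ge0 // subr_ge0.
  by apply: (orlicz_nondecreasing ophi) => //; have := a0 j; lra.
have shrink (t : R) : 0 < t < 1 -> \sum_(j < n) phi (a j) * w j - (1 - t) * C <= b.
  move=> /andP[t0 t1].
  have [i|s [us ss sc]] := greedy_rearrangement x (fun i => t * a i) _ n.
    have [->|ai] := eqVneq (a i) 0; [by left; rewrite mulr0|right].
    have ai0 : 0 < a i by rewrite lt_def ai a0.
    by rewrite mulr_gt0 // xa lte_fin gtr_pMl.
  apply: le_trans (hs s us ss); rewrite /C mulr_sumr -sumrB /arrangement_sum ss.
  apply: ler_sum => j _; rewrite mulrA -mulrBl; apply: ler_wpM2r => //.
  apply: le_trans (_ : phi (t * a j) <= _).
    by apply: (orlicz_shrink ophi) => //; rewrite !ltW.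
  by apply: (orlicz_nondecreasing ophi); [rewrite mulr_ge0 // ltW | apply: sc].
rewrite leNgt; apply/negP => lt.
set Sg := \sum_(j < n) _ in lt shrink.
(* Small enough that the loss [e * C] stays below the assumed gap [Sg - b]. *)
pose e := Num.min (2^-1) ((Sg - b) / (2 * (C + 1))).
have e0 : 0 < e.
  by rewrite /e lt_min invr_gt0 ltr0n /=; apply: divr_gt0; lra.
have e1 : e <= 2^-1 by rewrite /e ge_min lexx.
have e2 : e * (2 * (C + 1)) <= Sg - b.
  by rewrite -ler_pdivlMr; [rewrite /e ge_min lexx orbT|lra].
have t01 : 0 < 1 - e < 1 by apply/andP; split; lra.
have := shrink _ t01; have : 0 <= e * C by rewrite mulr_ge0 // ltW.
by nra.
Qed.

Section modular.
Context {phi : R -> R} {w : nat -> R}.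
Hypotheses (ophi : orlicz_function phi) (ww : weight_sequence w).
Let w0 i : 0 <= w i := ltW (weight_gt0 ww i).

Lemma er_map_ge0 (f : R -> R) (a : \bar R) : (forall t, 0 <= t -> 0 <= f t) ->
  (0 <= a)%E -> (0 <= er_map f a)%E.
Proof. by move=> f0; case: a => [r||] //=; rewrite !lee_fin => /f0. Qed.

Lemma modular_term_ge0 x i : (0 <= er_map phi (rearrangement x i) * (w i)%:E)%E.
Proof.
rewrite mule_ge0 ?lee_fin // er_map_ge0 ?rearrangement_ge0 //.
exact: orlicz_ge0 ophi.
Qed.

Lemma modular_ge0 x : (0 <= modular phi w x)%E.
Proof. by apply: nneseries_ge0 => i _ _; apply: modular_term_ge0. Qed.

Lemma modular_partial x n :
  (\sum_(i < n) er_map phi (rearrangement x i) * (w i)%:E <= modular phi w x)%E.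
Proof.
rewrite /modular; apply: le_trans (nneseries_lim_ge n _).
  by rewrite big_mkord.
by move=> i _ _; apply: modular_term_ge0.
Qed.

Lemma modular_pinfty x : rearrangement x 0 = +oo%E -> modular phi w x = +oo%E.
Proof.
move=> x0; apply/eqP; rewrite -leye_eq; apply: le_trans (modular_partial x 1).
by rewrite big_ord1 x0 /= mulyr gtr0_sg ?mul1e // (weight_gt0 ww).
Qed.

Lemma arrangement_le_modular x s : uniq s ->
  ((arrangement_sum phi w x s)%:E <= modular phi w x)%E.
Proof.
move=> us; have [x0|x0] := eqVneq (rearrangement x 0) +oo%E.
  by rewrite modular_pinfty // leey.
have xa := rearrangement_fin x _; rewrite ltey in xa; have {}xa := xa x0.
apply: le_trans (modular_partial x (size s)).
under [leRHS]eq_bigr do rewrite xa /= -EFinM.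
rewrite sumEFin lee_fin.
by apply: (arrangement_sum_le _ _ _ (fun i => fine (rearrangement x i))) => //;
  apply: weight_nonincreasing ww.
Qed.

Lemma modular_le_fin x (b : R) :
  (forall s, uniq s -> arrangement_sum phi w x s <= b) -> (modular phi w x <= b%:E)%E.
Proof.
move=> hs; have x0 : (rearrangement x 0 < +oo)%E.
  (* One-element lists bound every [phi |x k| * w 0] by [b], and [phi] grows at least linearly
     beyond 1. Thus [x] is bounded and its rearrangement finite. *)
  pose M := 1 + (b / (phi 1 * w 0%N)).
  apply: le_lt_trans (_ : (Num.max M 1)%:E < +oo)%E; last exact: ltry.
  apply: rearrangement0_le => k; rewrite le_max.
  have [_|k1] := leP `|x k| 1; [by rewrite orbT|rewrite orbF].
  have p1 : 0 < phi 1 * w 0%N by rewrite mulr_gt0 ?(orlicz_gt0 ophi) // (weight_gt0 ww).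
  have := hs [:: k] isT; rewrite /arrangement_sum /= big_ord1 /= => h.
  have := @orlicz_slope _ _ ophi 0 1 `|x k| (lexx _) ler01 (ltW k1).
  rewrite (orlicz_0 ophi) !subr0 mulr1 => h1.
  have : phi 1 * `|x k| <= phi `|x k| by lra.
  move=> /(ler_wpM2r (w0 0%N)) h2; rewrite /M -lerBlDl.
  rewrite ler_pdivlMr //; lra.
have xa := rearrangement_fin x x0.
apply: lime_le; first by apply: is_cvg_nneseries => i _ _; apply: modular_term_ge0.
apply: nearW => n; rewrite big_mkord.
under eq_bigr do rewrite xa /= -EFinM.
rewrite sumEFin lee_fin.
apply: (rearrangement_sum_le phi w x (fun i => fine (rearrangement x i)) b n ophi w0 xa) => s us _.
exact: hs.
Qed.

Lemma modular_le x (B : \bar R) :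
  (forall s, uniq s -> (arrangement_sum phi w x s)%:E <= B)%E -> (modular phi w x <= B)%E.
Proof.
case: B => [b||] hs; first by apply: modular_le_fin => s /hs.
  exact: leey.
by have := hs [::] isT.
Qed.

End modular.
End arrangement_sums.

(** * Monotonicity, disjoint supports and vanishing tails of the modular *)

Section arrangement_consequences.
Context {R : realType} {phi : R -> R} {w : nat -> R}.
Hypotheses (ophi : orlicz_function phi) (ww : weight_sequence w).
Implicit Types (x z u : nat -> R).
Let w0 i : 0 <= w i := ltW (weight_gt0 ww i).
Local Notation modular := (modular phi w).

Definition head_part n x : nat -> R := fun i => if (i < n)%N then x i else 0.
Definition tail_part n x : nat -> R := fun i => if (i < n)%N then 0 else x i.

Lemma le_modular x z : (forall i, `|x i| <= `|z i|) -> (modular x <= modular z)%E.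
Proof.
move=> xz; apply: (modular_le ophi ww) => s us.
apply: le_trans (arrangement_le_modular ophi ww z s us); rewrite lee_fin.
by apply: ler_sum => j _; apply: ler_wpM2r => //; apply: (orlicz_nondecreasing ophi).
Qed.

(** For each fixed list, [phi |x + z| = phi |x| + phi |z|] holds entry by entry with the same
    weight, so no rearrangement of the sum is needed. *)
Lemma modular_disjoint x z : (forall i, x i = 0 \/ z i = 0) ->
  (modular (fun i => x i + z i)%R <= modular x + modular z)%E.
Proof.
move=> xz; apply: (modular_le ophi ww) => s us.
apply: le_trans (leeD (arrangement_le_modular ophi ww x s us) (arrangement_le_modular ophi ww z s us)).
rewrite -EFinD lee_fin /arrangement_sum -big_split /=; apply: ler_sum => j _.
rewrite -mulrDl; apply: ler_wpM2r => //.
by case: (xz (nth 0%N s j)) => ->; rewrite ?addr0 ?add0r normr0 (orlicz_0 ophi) ?addr0 ?add0r.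
Qed.

Lemma modular_single (c : R) n : (modular (fun i => if i == n then c else 0)%R < +oo)%E.
Proof.
apply: (@le_lt_trans _ _ (phi `|c| * w 0%N)%:E); last exact: ltry.
apply: (modular_le ophi ww) => s us; rewrite lee_fin /arrangement_sum.
have pc : 0 <= phi `|c| * w 0%N by rewrite mulr_ge0 // (orlicz_ge0 ophi).
have wd i : w i <= w 0%N by apply: (weight_nonincreasing ww).
have [ns|ns] := boolP (n \in s); last first.
  rewrite big1 // => j _; case: ifPn => [/eqP jn|_]; last by rewrite normr0 (orlicz_0 ophi) mul0r.
  by move: ns; rewrite -jn mem_nth.
have idx : (index n s < size s)%N by rewrite index_mem.
rewrite (bigD1 (Ordinal idx)) //= nth_index // eqxx big1.
  by rewrite addr0 ler_wpM2l // (orlicz_ge0 ophi).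
move=> j /negP jn; case: ifPn => [/eqP hj|_]; last by rewrite normr0 (orlicz_0 ophi) mul0r.
by exfalso; apply: jn; apply/eqP/val_inj; rewrite /= -hj index_uniq.
Qed.

Lemma modular_finsupp x n : (forall i, (n <= i)%N -> x i = 0) -> (modular x < +oo)%E.
Proof.
elim: n x => [|n IH] x xn.
  apply: le_lt_trans (modular_single 0 0); apply: le_modular => i.
  by rewrite xn // normr0.
have -> : x = (fun i => head_part n x i + (if i == n then x n else 0)).
  apply/funext => i; rewrite /head_part; case: (ltngtP i n) => [|ni|->]; rewrite ?addr0 ?add0r //.
  by rewrite xn.
apply: le_lt_trans (modular_disjoint _ _ _) _; first last.
  apply: lte_add_pinfty; last exact: modular_single.
  by apply: IH => i ni; rewrite /head_part ltnNge ni.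
by move=> i; rewrite /head_part; case: (ltngtP i n) => ?; [right|left|left].
Qed.

Lemma weight_partial_unbounded (M : R) : exists n, M < \sum_(i < n) w i.
Proof.
apply: contrapT => nM; have /eqP := weight_sum ww.
rewrite -leye_eq leNgt => /negP; apply; apply: (@le_lt_trans _ _ M%:E); last exact: ltry.
apply: lime_le; first by apply: is_cvg_nneseries => i _ _; rewrite lee_fin.
apply: nearW => n; rewrite big_mkord sumEFin lee_fin leNgt; apply/negP => h.
by apply: nM; exists n.
Qed.

(** Otherwise arbitrarily many indices carry values above [d]; since the weights have infinite sum,
    the arrangement sums would exceed the modular. *)
Lemma modular_fin_cvg0 x (d : R) : (modular x < +oo)%E -> 0 < d ->
  exists N, forall i, (N <= i)%N -> `|x i| <= d.
Proof.
move=> mx d0; have pd : 0 < phi d := orlicz_gt0 ophi d0.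
have mE : modular x = (fine (modular x))%:E.
  by rewrite fineK // ge0_fin_numE // (modular_ge0 ophi ww).
have [n hn] := weight_partial_unbounded (fine (modular x) / phi d).
apply: contrapT => nN.
have large N : exists i, (N <= i)%N /\ d < `|x i|.
  apply: contrapT => h; apply: nN; exists N => i Ni.
  by rewrite leNgt; apply/negP => lt; apply: h; exists i.
have [s [us ss sd]] : exists s : seq nat, [/\ uniq s, size s = n & {in s, forall k, d < `|x k|}].
  elim: (n) => [|m [s [us ss sd]]]; first by exists [::].
  have [k [hk kd]] := large (\max_(k <- s) k).+1.
  exists (k :: s); split => /=; last by move=> j; rewrite in_cons => /orP[/eqP->//|/sd].
    rewrite us andbT; apply/negP => ks.
    by have := @leq_bigmax_seq _ s xpredT id _ ks isT; rewrite /= leqNgt hk.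
  by rewrite ss.
have := arrangement_le_modular ophi ww x s us; rewrite mE lee_fin leNgt => /negP; apply.
apply: lt_le_trans (_ : phi d * \sum_(i < n) w i <= _).
  by rewrite mulrC -ltr_pdivrMr.
rewrite /arrangement_sum ss mulr_sumr; apply: ler_sum => j _.
apply: ler_wpM2r => //; apply: (orlicz_nondecreasing ophi); first exact: ltW.
by apply/ltW/sd/mem_nth; rewrite ss.
Qed.

(** Fix a list [s] whose sum comes within [e / 2] of the modular. In any list for a far tail, the
    first [size s] entries contribute little because the values are small. The later entries can be
    appended to [s], so they contribute at most the remaining [e / 2]. *)
Lemma modular_tail_cvg0 x (e : R) : (modular x < +oo)%E -> 0 < e ->
  exists N, forall n, (N <= n)%N -> (modular (tail_part n x) <= e%:E)%E.
Proof.
move=> mx e0.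
have mE : modular x = (fine (modular x))%:E.
  by rewrite fineK // ge0_fin_numE // (modular_ge0 ophi ww).
have [s us hs] : exists2 s, uniq s & fine (modular x) - e / 2 < arrangement_sum phi w x s.
  apply: contrapT => h.
  have : (modular x <= (fine (modular x) - e / 2)%:E)%E.
    apply: (modular_le ophi ww) => s us; rewrite lee_fin leNgt; apply/negP => lt.
    by apply: h; exists s.
  by rewrite {1}mE lee_fin; lra.
pose m := size s; pose C := \sum_(i < m) w i.
have C0 : 0 <= C by apply: sumr_ge0.
have [d d0 dP] : exists2 d : R, 0 < d & phi d * C <= e / 2.
  (* For [t <= 1] convexity gives [phi t <= t * phi 1], so this choice makes [phi t * C] at most
     [e / 2]. *)
  pose t := Num.min 1 (e / 2 / (phi 1 * C + 1)).
  have p1 := orlicz_gt0 ophi (ltr01 : (0:R) < 1).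
  have q0 : 0 <= phi 1 * C by rewrite mulr_ge0 // ltW.
  have t0 : 0 < t by rewrite /t lt_min ltr01 /=; apply: divr_gt0; lra.
  have t1 : t <= 1 by rewrite /t ge_min lexx.
  have t2 : t * (phi 1 * C + 1) <= e / 2.
    by rewrite -ler_pdivlMr; [rewrite /t ge_min lexx orbT|lra].
  exists t => //.
  have : phi t <= t * phi 1.
    have := @orlicz_cvx _ _ ophi 1 0 t ler01 (lexx _).
    by rewrite mulr1 mulr0 !addr0 (orlicz_0 ophi) mulr0 addr0; apply; rewrite ltW.
  by move=> /(ler_wpM2r C0); nra.
have [N0 hN0] := modular_fin_cvg0 x d mx d0.
exists (maxn N0 (\max_(k <- s) k).+1) => n; rewrite geq_max => /andP[N0n sn].
apply: (modular_le ophi ww) => t ut; rewrite lee_fin.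
have td i : phi `|tail_part n x i| <= phi d.
  apply: (orlicz_nondecreasing ophi) => //; rewrite /tail_part; case: ltnP => [_|ni].
    by rewrite normr0 ltW.
  by apply: hN0; apply: leq_trans ni.
have [tm|mt] := leqP (size t) m.
  apply: le_trans (_ : phi d * C <= _); last by lra.
  rewrite /arrangement_sum /C mulr_sumr.
  rewrite (big_ord_widen _ (fun j => phi `|tail_part n x (nth 0%N t j)| * w j) tm).
  rewrite big_mkcond /=; apply: ler_sum => j _; case: ifP => _.
    exact: ler_wpM2r.
  by rewrite mulr_ge0 // (orlicz_ge0 ophi) // ltW.
have := arrangement_cat phi w (tail_part n x) (take m t) (drop m t); rewrite cat_take_drop => ->.
have stm : size (take m t) = m by rewrite size_takel // ltnW.
have h1 : arrangement_sum phi w (tail_part n x) (take m t) <= e / 2.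
  by apply: le_trans dP; rewrite /arrangement_sum stm mulr_sumr; apply: ler_sum => j _; apply: ler_wpM2r.
(* Entries of [t] below [n] contribute nothing, so they can be moved to fresh indices,
   which makes the concatenation of [s] with the end of [t] duplicate-free. *)
pose B := (n + (\max_(k <- t) k).+1)%N.
have tB k : k \in t -> (k < B)%N.
  move=> kt; have := @leq_bigmax_seq _ t xpredT id _ kt isT; rewrite /= /B -ltnS => h.
  by apply: leq_trans h _; rewrite leq_addl.
pose f k := if (k < n)%N then (k + B)%N else k.
have fn k : (n <= f k)%N.
  by rewrite /f; case: ltnP => // _; rewrite /B addnCA leq_addr.
pose r := map f (drop m t).
have ust : uniq (s ++ r).
  rewrite cat_uniq us; apply/andP; split => //; apply/andP; split.
    apply/hasPn => k /mapP[k' _ ->]; apply/negP => ks.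
    have := @leq_bigmax_seq _ s xpredT id _ ks isT; rewrite /= leqNgt.
    by rewrite (leq_trans sn).
  rewrite map_inj_in_uniq ?drop_uniq // => k1 k2 /mem_drop k1t /mem_drop k2t.
  rewrite /f; case: ifP => _; case: ifP => _ //.
  - by move=> /addIn.
  - by move=> h; have := tB _ k2t; rewrite -h ltnNge leq_addl.
  - by move=> h; have := tB _ k1t; rewrite h ltnNge leq_addl.
have := arrangement_le_modular ophi ww x _ ust; rewrite mE lee_fin arrangement_cat size_map => h2.
suff h3 : \sum_(j < size (drop m t))
      phi `|tail_part n x (nth 0%N (drop m t) j)| * w (size (take m t) + j)%N
    <= \sum_(j < size (drop m t)) phi `|x (nth 0%N r j)| * w (size s + j)%N by lra.
rewrite stm; apply: ler_sum => j _; apply: ler_wpM2r => //.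
rewrite (nth_map 0%N) //; apply: (orlicz_nondecreasing ophi) => //.
by rewrite /tail_part /f; case: ltnP => _; rewrite ?normr0.
Qed.

End arrangement_consequences.

(** * The conjugate of the modular *)

Section submajorization.
Context {R : realType} {w : nat -> R}.
Hypothesis ww : weight_sequence w.
Let w0 i : 0 <= w i := ltW (weight_gt0 ww i).
Implicit Types (v : nat -> R) (s : seq nat).

(** Submajorization as a family of linear inequalities indexed by finite lists, from which convexity
    and closedness are immediate. *)
Definition submajorized_set : set (nat -> R) := [set v | (forall i, 0 <= v i) /\
  forall s, uniq s -> \sum_(k <- s) v k <= \sum_(j < size s) w j].

(** Lets the lemmas on arrangement sums, with constant weight 1, be applied to partial sums of a
    rearrangement. *)
Lemma orlicz_id : orlicz_function (fun t : R => t).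
Proof. by split => // t x y _ _. Qed.

Lemma arrangement_sum_id v s : (forall i, 0 <= v i) ->
  arrangement_sum (fun t => t) (fun=> 1) v s = \sum_(k <- s) v k.
Proof.
move=> v0; rewrite (big_nth 0%N) big_mkord; apply: eq_bigr => j _.
by rewrite mulr1 ger0_norm.
Qed.

Lemma submajorizedP v : (forall i, 0 <= v i) -> submajorized v w <-> submajorized_set v.
Proof.
move=> v0; have nd1 : nonincreasing_seq (fun _ : nat => 1 : R) by move=> m n _.
have l01 (i : nat) : (0 : R) <= 1 := ler01; split.
  move=> vw; split => // s us.
  have va : forall n, rearrangement v n = (fine (rearrangement v n))%:E.
    apply: rearrangement_fin; have := vw 1%N; rewrite !big_ord1 => h.
    by apply: le_lt_trans h _; rewrite ltry.
  rewrite -arrangement_sum_id //.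
  apply: le_trans (arrangement_sum_le _ _ _ (fun i => fine (rearrangement v i)) _
    orlicz_id l01 nd1 us va) _.
  have := vw (size s); under eq_bigr do rewrite va.
  by rewrite sumEFin lee_fin; under [X in _ -> X <= _]eq_bigr do rewrite mulr1.
move=> [_ vs] n.
have va : forall n, rearrangement v n = (fine (rearrangement v n))%:E.
  apply: rearrangement_fin; apply: (@le_lt_trans _ _ (w 0%N)%:E); last exact: ltry.
  apply: rearrangement0_le => i; rewrite ger0_norm //.
  by have := vs [:: i] isT; rewrite big_seq1 big_ord1.
under eq_bigr do rewrite va.
rewrite sumEFin lee_fin.
under eq_bigr do rewrite -[fine _]mulr1.
apply: (rearrangement_sum_le (fun t => t) (fun=> 1) v (fun i => fine (rearrangement v i)) _ _
  orlicz_id l01 va).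
by move=> s us <-; rewrite arrangement_sum_id //; apply: vs.
Qed.

(** List the first [n] indices by decreasing [phi |x|]; summation by parts then compares the values
    of [v] along this list with [w]. *)
Lemma hardy_littlewood (phi : R -> R) (x v : nat -> R) n :
  orlicz_function phi -> submajorized_set v ->
  ((\sum_(i < n) phi `|x i| * v i)%:E <= modular phi w x)%E.
Proof.
move=> ophi [v0 vs].
have [s' ps' ds'] := sort_decreasing (fun k => phi `|x k|) (iota 0 n).
have us' : uniq s' by rewrite (perm_uniq ps') iota_uniq.
have ss' : size s' = n by rewrite (perm_size ps') size_iota.
apply: le_trans (arrangement_le_modular ophi ww x s' us'); rewrite lee_fin.
have -> : \sum_(i < n) phi `|x i| * v i = \sum_(k <- s') phi `|x k| * v k.
  by rewrite (perm_big _ ps') /= -(big_mkord xpredT (fun i => phi `|x i| * v i)) /index_iota subn0.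
rewrite (big_nth 0%N) big_mkord /arrangement_sum.
apply: (@abel_le _ (size s') (fun j => phi `|x (nth 0%N s' j)|) (fun j => v (nth 0%N s' j)) w).
- by move=> j _; apply: orlicz_ge0 ophi _ _.
- by move=> j js; apply: ds'; rewrite leqnSn.
move=> m ms; have <- : size (take m s') = m by rewrite size_takel.
apply: le_trans (vs (take m s') (take_uniq _ us')).
rewrite (big_nth 0%N) big_mkord; apply: ler_sum => j _.
have jm : (j < m)%N by apply: leq_trans (ltn_ord j) _; rewrite size_takel.
by rewrite nth_take.
Qed.

(** After sorting, the entry at position [j] is at least [j], and [w] is non-increasing. *)
Lemma sum_weight_uniq s : uniq s -> \sum_(k <- s) w k <= \sum_(j < size s) w j.
Proof.
move=> us; have ps : perm_eq (sort leq s) s by rewrite perm_sort.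
rewrite -(perm_big _ ps) (big_nth 0%N) big_mkord (perm_size ps).
apply: ler_sum => j _; apply: (weight_nonincreasing ww).
have st : sorted ltn (sort leq s).
  by rewrite ltn_sorted_uniq_leq sort_uniq us sort_sorted //; apply: leq_total.
have := ltn_ord j; rewrite -{2}(perm_size ps); elim: (nat_of_ord j) => // i IH iS.
apply: leq_ltn_trans (IH (ltnW iS)) _.
by apply: (sorted_ltn_nth ltn_trans 0%N st) => //; rewrite inE // ltnW.
Qed.

(** The weight carried along [s]: the submajorized sequence against which [phi |u|] sums to the
    arrangement sum of [u] over [s]. *)
Definition transported_weight s : nat -> R := fun k => if k \in s then w (index k s) else 0.

(** Distinct entries of [t] that lie in [s] have distinct positions in [s], so the bound for sums of
    [w] over distinct indices applies. *)
Lemma transported_weight_submajorized s : submajorized_set (transported_weight s).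
Proof.
split => [i|t ut]; first by rewrite /transported_weight; case: ifP.
rewrite /transported_weight -big_mkcond -big_filter /=.
set r := [seq k <- t | k \in s].
have ur : uniq (map (index^~ s) r).
  rewrite map_inj_in_uniq ?filter_uniq // => i j; rewrite !mem_filter => /andP[iS _] /andP[jS _] ij.
  by rewrite -(nth_index 0%N iS) ij nth_index.
have := sum_weight_uniq _ ur; rewrite big_map size_map => /le_trans; apply.
have rt : (size r <= size t)%N by rewrite size_filter count_size.
rewrite (big_ord_widen _ w rt) [leLHS]big_mkcond /=; apply: ler_sum => j _.
by case: ifP.
Qed.

Lemma transported_weight_sum (phi : R -> R) (u : nat -> R) n s : orlicz_function phi ->
  uniq s -> (forall i, (n <= i)%N -> u i = 0) ->
  \sum_(i < n) phi `|u i| * transported_weight s i = arrangement_sum phi w u s.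
Proof.
move=> ophi us un; rewrite /arrangement_sum.
have -> : \sum_(j < size s) phi `|u (nth 0%N s j)| * w j
    = \sum_(k <- s) phi `|u k| * transported_weight s k.
  rewrite [RHS](big_nth 0%N) big_mkord; apply: eq_bigr => j _.
  by rewrite /transported_weight mem_nth // index_uniq.
rewrite (bigID (fun k => (k < n)%N)) /= [X in _ = _ + X]big1 ?addr0; last first.
  by move=> k; rewrite -leqNgt => /un ->; rewrite normr0 (orlicz_0 ophi) mul0r.
rewrite -(big_mkord xpredT (fun i => phi `|u i| * transported_weight s i)).
rewrite (bigID (mem s)) /= [X in _ + X]big1 ?addr0; last first.
  by move=> k /negPf ks; rewrite /transported_weight ks mulr0.
rewrite -big_filter -[RHS]big_filter; apply: perm_big.
apply: uniq_perm; rewrite ?filter_uniq ?iota_uniq // => k.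
by rewrite !mem_filter mem_index_iota /= andbC.
Qed.

End submajorization.

(** * Compactness of the set of submajorized sequences *)

Section compactness.
Context {R : realType}.
Local Notation seqR := (prod_topology (fun _ : nat => (R : topologicalType))).

Lemma affine_continuous (c d : nat -> R) (s : seq nat) :
  continuous (fun v : seqR => \sum_(i <- s) (c i + d i * v i)).
Proof.
elim: s => [|k s IH].
  have -> : (fun v : seqR => \sum_(i <- [::]) (c i + d i * v i)) = cst 0.
    by apply/funext => v; rewrite big_nil.
  exact: cst_continuous.
have -> : (fun v : seqR => \sum_(i <- k :: s) (c i + d i * v i)) =
    (fun v : seqR => (c k + d k * v k) + \sum_(i <- s) (c i + d i * v i)).
  by apply/funext => v; rewrite big_cons.
move=> v; have pv : (fun u : seqR => u k) x @[x --> v] --> v k.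
  exact: (@proj_continuous _ (fun _ : nat => (R : topologicalType)) k v).
have cv : (fun u : seqR => c k + d k * u k) x @[x --> v] --> c k + d k * v k.
  by apply: (@cvgD R R seqR (nbhs v) _ (cst (c k)) (fun u => d k * u k)); [exact: cvg_cst|];
    exact: (@cvgMl_tmp R seqR (nbhs v) _ (fun u => u k) (d k)).
exact: (@cvgD R R seqR (nbhs v) _ (fun u => c k + d k * u k) _ _ _ cv (IH v)).
Qed.

Lemma closed_affine_le (c d : nat -> R) (s : seq nat) (b : R) :
  closed [set v : seqR | \sum_(i <- s) (c i + d i * v i) <= b].
Proof.
pose f (v : seqR) : R := \sum_(i <- s) (c i + d i * v i).
have /continuous_closedP cf : continuous f := affine_continuous c d s.
exact: cf (@closed_le R b).
Qed.

Lemma submajorized_set_compact (w : nat -> R) : compact (@submajorized_set R w : set seqR).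
Proof.
pose box : set seqR := [set v | forall i, `[0, w 0%N]%classic (v i)].
have cbox : compact box.
  apply: (@tychonoff _ (fun _ : nat => (R : topologicalType)) (fun=> `[0, w 0%N]%classic)) => i.
  exact: (@segment_compact R 0 (w 0%N)).
(* Both constraints are put in the affine form of [closed_affine_le]; the box is compact by
   Tychonoff's theorem. *)
pose C1 (i : nat) : set seqR := [set v | \sum_(k <- [:: i]) (0 + (-1) * v k) <= 0].
pose C2 (s : seq nat) : set seqR := [set v | \sum_(k <- s) (0 + 1 * v k) <= \sum_(j < size s) w j].
have -> : (@submajorized_set R w : set seqR) =
    box `&` ((\bigcap_i C1 i) `&` (\bigcap_(s in [set s | uniq s]) C2 s)).
  apply/seteqP; split => v.
    move=> [v0 vs]; split; first move=> i.
      rewrite /= in_itv /= v0 /=.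
      by have := vs [:: i] isT; rewrite big_seq1 big_ord1.
    split; first by move=> i _; rewrite /C1 /= big_seq1 add0r mulN1r oppr_le0.
    move=> s us; rewrite /C2 /=; under eq_bigr do rewrite add0r mul1r.
    exact: vs.
  move=> [bv [_ vs]]; split.
    by move=> i; have := bv i; rewrite /= in_itv /= => /andP[].
  by move=> s us; have := vs s us; rewrite /C2 /=; under eq_bigr do rewrite add0r mul1r.
apply: compact_closedI => //; apply: closedI; apply: closed_bigI => i _; exact: closed_affine_le.
Qed.

End compactness.

(** * The dual modular as a convex conjugate *)

Section p_modular_duality.
Context {R : realType} {phi : R -> R} {w : nat -> R}.
Hypotheses (nphi : N_function phi) (ww : weight_sequence w).
Let oph := N_orlicz nphi.
Local Notation psi := (complementary phi).
Local Notation K := (@submajorized_set R w).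
Implicit Types (x y h u v : nat -> R).

Lemma p_summand_ge0 (a b : R) : 0 <= b -> (0 <= p_summand psi a b)%E.
Proof.
move=> b0; rewrite /p_summand; case: ifP => _; first by case: ifP.
by rewrite lee_fin mulr_ge0 // (complementary_ge0 nphi).
Qed.

(** Young's inequality scaled by [b]. With the next lemma, [p_summand] is the supremum over [u >= 0]
    of [u * |a| - phi u * b], the degenerate case [b = 0] included. *)
Lemma p_summand_ub (u a b : R) : 0 <= u -> 0 <= b ->
  ((u * `|a| - phi u * b)%:E <= p_summand psi a b)%E.
Proof.
move=> u0 b0; rewrite /p_summand; case: ifP => [/eqP->|/eqP/eqP bn].
  by case: ifP => [/eqP->|_]; rewrite ?leey // normr0 !mulr0 subrr.
have bp : 0 < b by rewrite lt_def bn.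
rewrite lee_fin; have := young nphi u (`|a| / b) u0 => /(ler_wpM2r b0).
by rewrite mulrDl -!mulrA mulVf // mulr1; lra.
Qed.

Lemma p_summand_le (a b c : R) : 0 <= b ->
  (forall u : R, 0 <= u -> u * `|a| - phi u * b <= c) -> (p_summand psi a b <= c%:E)%E.
Proof.
move=> b0 h; rewrite /p_summand; case: ifP => [/eqP b00|/eqP/eqP bn].
  case: ifP => [/eqP a0|/eqP/eqP an].
    by have := h 0 (lexx _); rewrite a0 b00 normr0 !mulr0 subrr lee_fin.
  exfalso; have an0 : 0 < `|a| by rewrite normr_gt0.
  (* With [b = 0] the bound is linear in [u], and this [u] pushes it above [c] unless [a = 0]. *)
  have := h ((`|c| + 1) / `|a|); rewrite b00 mulr0 subr0 divfK ?gt_eqF //.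
  by rewrite divr_ge0 // ?addr_ge0 // => /(_ isT); have := ler_norm c; lra.
have bp : 0 < b by rewrite lt_def bn.
rewrite lee_fin -ler_pdivlMr //; apply: (complementary_le) => u u0.
rewrite ler_pdivlMr // mulrBl -mulrA divfK //; exact: h.
Qed.

Lemma p_summands_ub x h v n : K v ->
  ((\sum_(i < n) `|x i * h i|)%:E <=
   modular phi w x + \sum_(0 <= i <oo) p_summand psi (h i) (v i))%E.
Proof.
move=> Kv; have [v0 _] := Kv.
apply: le_trans (leeD (hardy_littlewood ww phi x v n oph Kv)
  (nneseries_lim_ge n (fun i _ _ => p_summand_ge0 (h i) (v i) (v0 i)))).
rewrite big_mkord -sumEFin -sumEFin -big_split /=; apply: lee_sum => i _.
rewrite addrC -leeBlDr //; rewrite -EFinB normrM.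
exact: p_summand_ub.
Qed.

Lemma p_modular_ge0 h : (0 <= p_modular psi w h)%E.
Proof.
apply: le_ereal_inf_tmp => _ [v [v0 _] <-]; apply: nneseries_ge0 => i _ _.
exact: p_summand_ge0.
Qed.

Lemma p_modular_ub x h n : (modular phi w x < +oo)%E ->
  ((\sum_(i < n) `|x i * h i|)%:E <= modular phi w x + p_modular psi w h)%E.
Proof.
move=> mx; have mf : modular phi w x \is a fin_num.
  by rewrite ge0_fin_numE // (modular_ge0 oph ww).
rewrite -leeBlDl //; apply: le_ereal_inf_tmp => _ [v [v0 vw] <-].
by rewrite leeBlDl //; apply/p_summands_ub/submajorizedP.
Qed.

(** The supremum over [u] separates into coordinates: with the last coordinate frozen at [t],
    induction bounds the others, and then [t] varies. *)
Lemma p_summands_le y v (D : R) n : (forall i, 0 <= v i) ->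
  (forall u, (forall i, 0 <= u i) -> \sum_(i < n) (u i * `|y i| - phi (u i) * v i) <= D) ->
  (\sum_(i < n) p_summand psi (y i) (v i) <= D%:E)%E.
Proof.
move=> v0; elim: n D => [|n IH] D hD.
  by have := hD (fun=> 0) (fun=> lexx _); rewrite !big_ord0 lee_fin.
have S0 : (0 <= \sum_(i < n) p_summand psi (y i) (v i))%E.
  by apply: sume_ge0 => i _; apply: p_summand_ge0.
have hS (t : R) : 0 <= t ->
    (\sum_(i < n) p_summand psi (y i) (v i) <= (D - (t * `|y n| - phi t * v n))%:E)%E.
  move=> t0; apply: IH => u u0.
  have := hD (fun i => if i == n then t else u i); rewrite big_ord_recr /= eqxx.
  under eq_bigr => i _ do rewrite (ltn_eqF (ltn_ord i)).
  by move=> h; rewrite lerBrDr; apply: h => i; case: ifP.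
have Sf : (\sum_(i < n) p_summand psi (y i) (v i))%E \is a fin_num.
  by rewrite ge0_fin_numE //; apply: le_lt_trans (hS 0 (lexx _)) _; apply: ltry.
rewrite big_ord_recr /= -leeBrDl // -(fineK Sf) -EFinB.
apply: p_summand_le => // t t0.
by have := hS t t0; rewrite -(fineK Sf) lee_fin; lra.
Qed.

(** Concave in the multiplier [u], affine in [v]. The pair records a bound on the support of [u], so
    the sum is finite. *)
Definition lagrangian y (p : nat * (nat -> R)) v : R :=
  \sum_(i < p.1) (p.2 i * `|y i| - phi (p.2 i) * v i).

Definition finsupp_nonneg : set (nat * (nat -> R)) :=
  [set p | (forall i, 0 <= p.2 i) /\ forall i, (p.1 <= i)%N -> p.2 i = 0].

Lemma lagrangian_widen y n m u v : (n <= m)%N -> finsupp_nonneg (n, u) ->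
  lagrangian y (n, u) v = lagrangian y (m, u) v.
Proof.
move=> nm [_ /= un]; rewrite /lagrangian /=.
rewrite (big_ord_widen _ (fun i => u i * `|y i| - phi (u i) * v i) nm) big_mkcond /=.
apply: eq_bigr => i _; case: ltnP => // /un ->.
by rewrite (orlicz_0 oph) !mul0r subrr.
Qed.

Lemma lagrangian_convex y p (c : R) (A : set (nat -> R)) :
  cvx_on A (fun v => lagrangian y p v - c).
Proof.
move=> a b t _ _ _; have -> : lagrangian y p (t *: a + (1 - t) *: b) =
    t * lagrangian y p a + (1 - t) * lagrangian y p b.
  rewrite /lagrangian !mulr_sumr -big_split /=; apply: eq_bigr => i _.
  have -> : (t *: a + (1 - t) *: b) i = t * a i + (1 - t) * b i by [].
  ring.
by rewrite le_eqVlt; apply/orP; left; apply/eqP; ring.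
Qed.

Lemma submajorized_set_convex : cvx_set K.
Proof.
move=> a b t [a0 ha] [b0 hb] /andP[t0 t1].
have t1' : 0 <= 1 - t by rewrite subr_ge0.
have E i : (t *: a + (1 - t) *: b) i = t * a i + (1 - t) * b i by [].
split=> [i|s us]; first by rewrite E addr_ge0 // mulr_ge0.
under eq_bigr do rewrite E.
rewrite big_split /= -!mulr_sumr.
have := ler_wpM2l t0 (ha s us); have := ler_wpM2l t1' (hb s us); lra.
Qed.

Lemma lagrangian_mix y (c : R) p1 p2 (t : R) : finsupp_nonneg p1 -> finsupp_nonneg p2 ->
  0 <= t <= 1 -> exists2 p, finsupp_nonneg p & forall v, (forall i, 0 <= v i) ->
    t * (lagrangian y p1 v - c) + (1 - t) * (lagrangian y p2 v - c) <= lagrangian y p v - c.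
Proof.
case: p1 p2 => [n1 u1] [n2 u2] P1 P2 /andP[t0 t1].
have t1' : 0 <= 1 - t by rewrite subr_ge0.
have [[u1p /= u1n] [u2p /= u2n]] := (P1, P2).
exists (maxn n1 n2, fun i => t * u1 i + (1 - t) * u2 i).
  split => /= [i|i]; first by rewrite addr_ge0 ?mulr_ge0.
  by rewrite geq_max => /andP[/u1n -> /u2n ->]; rewrite !mulr0 addr0.
move=> v v0.
rewrite (lagrangian_widen y _ _ _ v (leq_maxl n1 n2) P1).
rewrite (lagrangian_widen y _ _ _ v (leq_maxr n1 n2) P2).
suff : t * lagrangian y (maxn n1 n2, u1) v + (1 - t) * lagrangian y (maxn n1 n2, u2) v
  <= lagrangian y (maxn n1 n2, fun i => t * u1 i + (1 - t) * u2 i) v by lra.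
rewrite /lagrangian /= !mulr_sumr -big_split /=; apply: ler_sum => i _.
have t01 : 0 <= t <= 1 by rewrite t0.
have := orlicz_cvx oph (u1 i) (u2 i) t (u1p i) (u2p i) t01 => /(ler_wpM2r (v0 i)).
lra.
Qed.

(** If no [v] worked, the minimax theorem would give a single [p] whose Lagrangian is at least [c]
    on all of [K]. Evaluating it at the weight transported along a list with large arrangement sum
    contradicts [D < c]. *)
Lemma finite_family_lagrangian y (D c : R) (us : seq (nat * (nat -> R))) : D < c ->
  (forall p, finsupp_nonneg p ->
     ((\sum_(i < p.1) p.2 i * `|y i|)%:E <= D%:E + modular phi w p.2)%E) ->
  {in us, forall p, finsupp_nonneg p} ->
  exists v, K v /\ {in us, forall p, lagrangian y p v <= c}.
Proof.
move=> Dc hD us_nn; apply: contrapT => nv.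
have P0 : finsupp_nonneg (0%N, fun=> 0) by split.
have [|p Pp hp] := @finite_minimax R (nat -> R) _ finsupp_nonneg (fun p v => lagrangian y p v - c)
    [set v | forall i, 0 <= v i] _ P0 (fun p _ => lagrangian_convex y p c _)
    (fun p1 p2 t => lagrangian_mix y c p1 p2 t) us K
    (fun v Kv => proj1 Kv) submajorized_set_convex us_nn.
  move=> v Kv; apply: contrapT => h; apply: nv; exists v; split => // p ps.
  rewrite leNgt; apply/negP => lt; apply: h; exists p => //.
  by rewrite subr_ge0 ltW.
pose S := \sum_(i < p.1) p.2 i * `|y i|.
have [pp pn] := Pp.
(* Otherwise the modular of [p.2] is at most [S - c], and the hypothesis gives [S <= D + S - c],
   against [D < c]. *)
have [s us' hs] : exists2 s, uniq s & S - c < arrangement_sum phi w p.2 s.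
  apply: contrapT => h.
  have hm : (modular phi w p.2 <= (S - c)%:E)%E.
    apply: (modular_le oph ww) => s us'; rewrite lee_fin leNgt; apply/negP => lt.
    by apply: h; exists s.
  have := le_trans (hD p Pp) (leeD (lexx D%:E) hm).
  by rewrite -EFinD lee_fin -/S; lra.
have := hp _ (transported_weight_submajorized ww s).
have : lagrangian y p (@transported_weight R w s) = S - arrangement_sum phi w p.2 s.
  rewrite /lagrangian sumrB -/S; congr (_ - _).
  rewrite -(transported_weight_sum phi p.2 p.1 s oph us' pn).
  by apply: eq_bigr => i _; rewrite ger0_norm.
by move=> ->; lra.
Qed.

(** Finite families of Lagrangian constraints are solvable in [K], so by compactness one [v]
    satisfies all of them. The slack [e] provides the strict inequality needed for finite
    families. *)
Lemma p_modular_le y (D : R) :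
  (forall p, finsupp_nonneg p ->
     ((\sum_(i < p.1) p.2 i * `|y i|)%:E <= D%:E + modular phi w p.2)%E) ->
  (p_modular psi w y <= D%:E)%E.
Proof.
move=> hD; apply/lee_addgt0Pr => e e0; rewrite -EFinD.
have Dc : D < D + e by rewrite ltrDl.
set c := D + e in Dc *.
pose seqR := prod_topology (fun _ : nat => (R : topologicalType)).
(* The solution sets of finite subfamilies generate a proper filter on [K]; its cluster point lies
   in every closed constraint. *)
pose B (us : seq (nat * (nat -> R))) : set seqR :=
  [set v | K v /\ {in us, forall p, lagrangian y p v <= c}].
pose G : set_system seqR := filter_from
  [set us : seq (nat * (nat -> R)) | {in us, forall p, finsupp_nonneg p}] B.
have FG : Filter G.
  apply: filter_from_filter; first by exists [::].
  move=> us1 us2 h1 h2; exists (us1 ++ us2).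
    by move=> p; rewrite mem_cat => /orP[/h1|/h2].
  by move=> v [Kv hv]; split; split => // p ps; apply: hv; rewrite mem_cat ps ?orbT.
have PG : ProperFilter G.
  by apply: filter_from_proper => us hus; apply: (finite_family_lagrangian _ D).
have GK : G (K : set seqR) by exists [::] => // v [].
have [v [Kv clv]] := submajorized_set_compact w G PG GK.
have hv p : finsupp_nonneg p -> lagrangian y p v <= c.
  move=> Pp.
  have := closed_affine_le (fun i => p.2 i * `|y i|) (fun i => - phi (p.2 i)) (iota 0 p.1) c.
  have E (u : nat -> R) : \sum_(i <- iota 0 p.1) (p.2 i * `|y i| + - phi (p.2 i) * u i) = lagrangian y p u.
    rewrite -{1}(subn0 p.1) -/(index_iota 0 p.1) big_mkord; apply: eq_bigr => i _.
    by rewrite mulNr.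
  move=> cl; have := cl v; rewrite /= E; apply => A nA.
  apply: clv => //; exists [:: p] => [q|u [_ hu]]; first by rewrite inE => /eqP->.
  by rewrite /= E; apply: hu; rewrite inE.
have [v0 _] := Kv.
apply: ge_ereal_inf; exists (\sum_(0 <= i <oo) p_summand psi (y i) (v i))%E.
  by exists v => //; split => //; apply/submajorizedP.
apply: lime_le.
  by apply: is_cvg_nneseries => i _ _; apply: p_summand_ge0.
apply: nearW => n; rewrite big_mkord; apply: p_summands_le => // u u0.
have := hv (n, head_part n u); rewrite /lagrangian /= /head_part.
under eq_bigr => i _ do rewrite ltn_ord.
apply; split => /= i; first by case: ifP.
by rewrite ltnNge => ->.
Qed.

End p_modular_duality.

(** * The Amemiya formula *)

Section amemiya.
Context {R : realType} {phi : R -> R} {w : nat -> R}.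
Hypotheses (nphi : N_function phi) (ww : weight_sequence w).
Let oph := N_orlicz nphi.
Let w0 i : 0 <= w i := ltW (weight_gt0 ww i).
Local Notation psi := (complementary phi).
Implicit Types (x z : nat -> R) (m : R).

Lemma er_young (a b : \bar R) : (0 <= a)%E -> (0 <= b)%E ->
  (a * b <= er_map phi a + er_map psi b)%E.
Proof.
case: a => [a||] //; case: b => [b||] //= a0 b0; rewrite ?leey //.
by rewrite -EFinM -EFinD lee_fin (young nphi).
Qed.

(** The easy half of the Amemiya formula: Young's inequality between the two rearrangements, summed
    against [w], bounds each pairing by [m + 1]. *)
Lemma orlicz_norm_scale_le x m : (modular phi w x <= m%:E)%E ->
  (orlicz_norm phi w (fun i => (1 + m)^-1 * x i)%R <= 1)%E.
Proof.
move=> xm; have m0 : 0 <= m by rewrite -lee_fin (le_trans (modular_ge0 oph ww x)).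
have c0 : 0 < 1 + m by lra.
have ci0 : 0 < (1 + m)^-1 by rewrite invr_gt0.
apply: ge_ereal_sup => _ [z /= zm <-].
have px i : (0 <= er_map phi (rearrangement x i) * (w i)%:E)%E by apply: (modular_term_ge0 oph ww).
have pz i : (0 <= er_map psi (rearrangement z i) * (w i)%:E)%E.
  rewrite mule_ge0 ?lee_fin // er_map_ge0 ?rearrangement_ge0 // => t _.
  exact: complementary_ge0 nphi _.
apply: (@le_trans _ _ (\sum_(0 <= i <oo) (1 + m)^-1%:E *
    (er_map phi (rearrangement x i) * (w i)%:E + er_map psi (rearrangement z i) * (w i)%:E))%E).
  apply: lee_nneseries => i _.
    by rewrite !mule_ge0 ?rearrangement_ge0 ?lee_fin.
  rewrite rearrangementZ // -!muleA; apply: lee_wpmul2l; first by rewrite lee_fin ltW.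
  rewrite muleA -ge0_muleDl; last 2 first.
  - by rewrite er_map_ge0 ?rearrangement_ge0 //; apply: (orlicz_ge0 oph).
  - by rewrite er_map_ge0 ?rearrangement_ge0 // => t _; apply: (complementary_ge0 nphi).
  by apply: lee_wpmul2r; rewrite ?lee_fin // er_young ?rearrangement_ge0.
rewrite nneseriesZl; last by move=> i _; rewrite adde_ge0.
rewrite nneseriesD //.
apply: (@le_trans _ _ ((1 + m)^-1%:E * (m%:E + 1%:E))%E).
  by apply: lee_wpmul2l; [rewrite lee_fin ltW|apply: leeD].
have -> : (m%:E + 1 = (1 + m)%:E)%E by rewrite addrC.
by rewrite -EFinM lee_fin mulVf // gt_eqF.
Qed.

Lemma orlicz_norm_ge0 x : (0 <= orlicz_norm phi w x)%E.
Proof.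
apply: ereal_sup_ubound; exists (fun=> 0); last first.
  by rewrite eseries0 // => i _ _; rewrite (rearrangement_decreasing (fun=> 0)) // mule0 mul0e.
rewrite /= /modular eseries0 // => i _ _.
by rewrite rearrangement_decreasing //= (complementary0 nphi) mul0e.
Qed.

(** Such sequences equal their rearrangement, so both the constraint and the pairing become finite
    sums. *)
Definition decreasing_finsupp : set (nat * (nat -> R)) :=
  [set p | [/\ forall i, 0 <= p.2 i, nonincreasing_seq p.2 & forall i, (p.1 <= i)%N -> p.2 i = 0]].

Lemma finsupp_sum_widen (F : R -> nat -> R) (z : nat -> R) (n m : nat) :
  (forall i, F 0 i = 0) -> (n <= m)%N ->
  (forall i, (n <= i)%N -> z i = 0) -> \sum_(i < n) F (z i) i = \sum_(i < m) F (z i) i.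
Proof.
move=> F0 nm zn; rewrite (big_ord_widen _ (fun i => F (z i) i) nm) big_mkcond /=.
by apply: eq_bigr => i _; case: ltnP => // /zn ->.
Qed.

Lemma decreasing_finsupp_orlicz_norm x (a : nat -> R) p :
  (forall i, rearrangement x i = (a i)%:E) -> decreasing_finsupp p ->
  \sum_(i < p.1) psi (p.2 i) * w i <= 1 ->
  ((\sum_(i < p.1) a i * p.2 i * w i)%:E <= orlicz_norm phi w x)%E.
Proof.
case: p => [n z] xa [/= z0 zd zn] pz.
have zE := rearrangement_decreasing z z0 zd.
have pw i : 0 <= psi (z i) * w i by rewrite mulr_ge0 // (complementary_ge0 nphi).
have zm : (modular psi w z <= 1)%E.
  rewrite /modular; under eq_eseriesr do rewrite zE /= -EFinM.
  apply: lime_le; first by apply: is_cvg_nneseries => i _ _; rewrite lee_fin.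
  apply: nearW => m; rewrite big_mkord sumEFin lee_fin; apply: le_trans pz.
  rewrite (finsupp_sum_widen (fun t i => psi t * w i) z n (maxn n m)) ?leq_maxl //; last first.
    by move=> i; rewrite (complementary0 nphi) mul0r.
  rewrite (big_ord_widen _ (fun i => psi (z i) * w i) (leq_maxr n m)) big_mkcond /=.
  by apply: ler_sum => i _; case: ifP.
apply: (@le_trans _ _ (\sum_(0 <= i <oo) rearrangement x i * rearrangement z i * (w i)%:E)%E).
  apply: le_trans (nneseries_lim_ge n _).
    rewrite big_mkord -sumEFin; apply: lee_sum => i _.
    by rewrite xa zE -!EFinM.
  by move=> i _ _; rewrite !mule_ge0 ?rearrangement_ge0 ?lee_fin.
by apply: ereal_sup_ubound; exists z.
Qed.

(* The nontrivial half of the Amemiya formula: a Lagrange multiplier for the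
   constraint [modular psi w z <= 1] provides [k]. *)
Lemma amemiya x (a : nat -> R) (N : R) : (forall i, rearrangement x i = (a i)%:E) ->
  a 0%N != 0 -> (orlicz_norm phi w x <= N%:E)%E ->
  exists2 k, 0 < k & (modular phi w (fun i => k * x i)%R <= (k * N - 1)%:E)%E.
Proof.
move=> xa an xN.
have a0 i : 0 <= a i by rewrite -lee_fin -xa rearrangement_ge0.
have ad i j : (i <= j)%N -> a j <= a i.
  by move=> ij; rewrite -lee_fin -!xa rearrangement_nonincreasing.
pose L (p : nat * (nat -> R)) := \sum_(i < p.1) a i * p.2 i * w i.
pose Psi (p : nat * (nat -> R)) := \sum_(i < p.1) psi (p.2 i) * w i.
have [p1 p2 t P1 P2 t01|p Pp|t [/andP[t0 t1] tP]] :=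
    two_convexlike_ge0 R (nat * (nat -> R)) decreasing_finsupp (fun p => N - L p) (fun p => Psi p - 1).
- case: p1 p2 P1 P2 => [n1 z1] [n2 z2] [/= z10 z1d z1n] [/= z20 z2d z2n].
  have /andP[t0 t1] := t01.
  have t1' : 0 <= 1 - t by rewrite subr_ge0.
  exists (maxn n1 n2, fun i => t * z1 i + (1 - t) * z2 i); split.
  + split => /= [i|i j ij|i]; first by rewrite addr_ge0 ?mulr_ge0.
      by rewrite lerD // ler_wpM2l // ?z1d ?z2d.
    by rewrite geq_max => /andP[/z1n -> /z2n ->]; rewrite !mulr0 addr0.
  + rewrite /L /= (finsupp_sum_widen (fun s i => a i * s * w i) z1 n1 (maxn n1 n2)) ?leq_maxl //; last first.
      by move=> i; rewrite mulr0 mul0r.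
    rewrite (finsupp_sum_widen (fun s i => a i * s * w i) z2 n2 (maxn n1 n2)) ?leq_maxr //; last first.
      by move=> i; rewrite mulr0 mul0r.
    suff -> : \sum_(i < maxn n1 n2) a i * (t * z1 i + (1 - t) * z2 i) * w i =
      t * \sum_(i < maxn n1 n2) a i * z1 i * w i + (1 - t) * \sum_(i < maxn n1 n2) a i * z2 i * w i by lra.
    by rewrite !mulr_sumr -big_split /=; apply: eq_bigr => i _; ring.
  + rewrite /Psi /= (finsupp_sum_widen (fun s i => psi s * w i) z1 n1 (maxn n1 n2)) ?leq_maxl //; last first.
      by move=> i; rewrite (complementary0 nphi) mul0r.
    rewrite (finsupp_sum_widen (fun s i => psi s * w i) z2 n2 (maxn n1 n2)) ?leq_maxr //; last first.
      by move=> i; rewrite (complementary0 nphi) mul0r.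
    suff : \sum_(i < maxn n1 n2) psi (t * z1 i + (1 - t) * z2 i) * w i <=
      t * \sum_(i < maxn n1 n2) psi (z1 i) * w i + (1 - t) * \sum_(i < maxn n1 n2) psi (z2 i) * w i by lra.
    rewrite !mulr_sumr -big_split /=; apply: ler_sum => i _.
    by have := complementary_cvx nphi (z1 i) (z2 i) t t01 => /(ler_wpM2r (w0 i)); lra.
- have [P1|P1] := leP (Psi p) 1; [left|right; lra].
  rewrite subr_ge0 -lee_fin; apply: le_trans xN.
  exact: decreasing_finsupp_orlicz_norm xa Pp P1.
(* For [t = 0] the zero sequence would violate the multiplier inequality. *)
have tgt0 : 0 < t.
  rewrite lt_def t0 andbT; apply/eqP => t00.
  have /tP : decreasing_finsupp (0%N, fun=> 0) by split.
  by rewrite t00 /L /Psi /= !big_ord0; lra.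
have tlt1 : t < 1.
  rewrite lt_def t1 andbT eq_sym; apply/eqP => t11.
  (* For [t = 1] every pairing would be at most [N], but the sequence with single entry [c] pairs to
     [|N| + 1]. *)
  pose c := (`|N| + 1) / (a 0%N * w 0%N).
  have aw0 : 0 < a 0%N * w 0%N by rewrite mulr_gt0 ?(weight_gt0 ww) // lt_def an a0.
  have c0 : 0 <= c by rewrite divr_ge0 ?(ltW aw0) // addr_ge0.
  have /tP : decreasing_finsupp (1%N, fun i => if i == 0%N then c else 0).
    split => /= [i|i j ij|i]; first by case: ifP.
      by case: i ij => [|i]; case: j.
    by case: i.
  rewrite t11 /L /Psi /= !big_ord1 /= subrr mul0r addr0 mul1r.
  have -> : a 0%N * c * w 0%N = `|N| + 1.
    by rewrite mulrAC /c mulrCA mulfV ?mulr1 // gt_eqF.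
  by have := ler_norm N; lra.
pose k := t / (1 - t).
have k0 : 0 < k by rewrite divr_gt0 // subr_gt0.
have kP p : decreasing_finsupp p -> k * L p - Psi p <= k * N - 1.
  move=> /tP h; have tk : t = k * (1 - t) by rewrite /k divfK // gt_eqF // subr_gt0.
  have u0 : 0 < 1 - t by rewrite subr_gt0.
  rewrite -(ler_pM2r u0).
  have -> : (k * L p - Psi p) * (1 - t) = t * L p - Psi p * (1 - t) by rewrite {2}tk; ring.
  have -> : (k * N - 1) * (1 - t) = t * N - (1 - t) by rewrite {2}tk; ring.
  lra.
have ka0 i : 0 <= k * a i by rewrite mulr_ge0 // ltW.
(* The optimal test sequence: equality in Young's inequality at [k * a i] turns [k * L - Psi] into
   the sum of [phi (k * a i) * w i]. *)
pose q i := @right_slope R phi (k * a i).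
have sum_le n : \sum_(i < n) phi (k * a i) * w i <= k * N - 1.
  have : decreasing_finsupp (n, head_part n q).
    split => /= [i|i j ij|i]; rewrite /head_part.
    - by case: ifP => // _; apply: (right_slope_ge0 nphi).
    - case: (ltnP j n) => jn; last by case: ifP => // _; apply: (right_slope_ge0 nphi).
      rewrite (leq_ltn_trans ij jn); apply: (right_slope_nondecreasing nphi) => //.
      by rewrite ler_wpM2l ?ad // ltW.
    - by rewrite ltnNge => ->.
  move=> /kP; apply: le_trans; rewrite /L /Psi /= mulr_sumr -sumrB.
  apply: ler_sum => i _; rewrite /head_part ltn_ord.
  have := right_slope_young nphi (k * a i) (ka0 i); rewrite -/(q i) => h.
  have -> : k * (a i * q i * w i) - psi (q i) * w i = (k * a i * q i - psi (q i)) * w i by ring.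
  by rewrite h addrK.
exists k => //; apply: (modular_le_fin oph ww) => s us; apply: le_trans (sum_le (size s)).
apply: (arrangement_sum_le phi w _ (fun i => k * a i)) => //; first exact: weight_nonincreasing ww.
by move=> i; rewrite rearrangementZ // xa.
Qed.

End amemiya.

(** * Regular and singular parts of a functional *)

(** Reduces each norm identity to an equivalence for a fixed positive [eta]. *)
Lemma ereal_inf_ge_eps (R : realType) (D : \bar R) : (0 <= D)%E ->
  D = ereal_inf [set eta%:E | eta in [set eta : R | 0 < eta /\ (D <= eta%:E)%E]].
Proof.
move=> D0; apply/eqP; rewrite eq_le; apply/andP; split.
  by apply: le_ereal_inf_tmp => _ /= [eta [_ h] <-].
case: D D0 => [d||] D0; rewrite ?leey //.
move: D0; rewrite lee_fin => d0; apply/lee_addgt0Pr => e e0; apply: ereal_inf_lbound.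
by exists (d + e) => //; split; rewrite ?lee_fin; lra.
Qed.

Section dual_norms.
Context {R : realType} {phi : R -> R} {w : nat -> R}.
Hypotheses (nphi : N_function phi) (ww : weight_sequence w).
Let oph := N_orlicz nphi.
Local Notation psi := (complementary phi).
Local Notation lorentz := (orlicz_lorentz phi w).
Local Notation modular := (modular phi w).
Implicit Types (x y z : nat -> R) (G : (nat -> R) -> R).

Lemma lorentz_modular x : (modular x < +oo)%E -> lorentz x.
Proof.
move=> mx; exists 1; first exact: ltr01.
by have -> : (fun i => 1 * x i) = x by apply/funext => i; rewrite mul1r.
Qed.

Lemma lorentz_le x z : (forall i, `|x i| <= `|z i|) -> lorentz z -> lorentz x.
Proof.
move=> xz [e e0 mz]; exists e; first exact: e0.
apply: le_lt_trans mz; apply: (le_modular oph ww) => i.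
by rewrite !normrM ler_wpM2l.
Qed.

Lemma lorentzZ (c : R) x : lorentz x -> lorentz (fun i => c * x i).
Proof.
move=> [e e0 mx]; have c0 : 0 < `|c| + 1 by rewrite ltr_wpDl.
exists (e / (`|c| + 1)); first exact: divr_gt0.
apply: le_lt_trans mx; apply: (le_modular oph ww) => i.
rewrite !normrM mulrA; apply: ler_wpM2r => //.
rewrite normfV (gtr0_norm c0) (gtr0_norm e0) mulrAC ler_pdivrMr // ler_wpM2l ?ltW //.
by rewrite ltrDl.
Qed.

Lemma lorentz_finsupp x n : (forall i, (n <= i)%N -> x i = 0) -> lorentz x.
Proof. by move=> xn; apply/lorentz_modular/(modular_finsupp oph ww _ n). Qed.

Lemma lorentz_rearrangement_fin x : lorentz x ->
  forall n, rearrangement x n = (fine (rearrangement x n))%:E.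
Proof.
move=> [e e0 mx]; apply: rearrangement_fin; rewrite ltNge leye_eq; apply/negP => /eqP x0.
move: mx; rewrite (modular_pinfty oph ww) ?ltxx // rearrangementZ // x0.
by rewrite gt0_muley.
Qed.

Lemma amemiya_lorentz x (N : R) : lorentz x -> (orlicz_norm phi w x <= N%:E)%E ->
  x = (fun=> 0) \/
  exists2 k, 0 < k & (modular (fun i => k * x i)%R <= (k * N - 1)%:E)%E.
Proof.
move=> /lorentz_rearrangement_fin xa xN.
have [a0|a0] := eqVneq (fine (rearrangement x 0)) 0; last first.
  by right; apply: (amemiya nphi ww x (fun n => fine (rearrangement x n))).
left; apply/funext => i; apply/eqP; rewrite -normr_le0 -lee_fin -a0 -xa.
by apply: (rearrangement_ge x [:: i]) => // k; rewrite inE => /eqP->.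
Qed.

Definition homogeneous G := forall (a : R) x, lorentz x -> G (fun i => a * x i) = a * G x.

Definition modular_bounded G (eta : R) :=
  forall x (m : R), (modular x <= m%:E)%E -> `|G x| <= eta * (1 + m).

Lemma modular_bound_ge0 x (m : R) : (modular x <= m%:E)%E -> 0 <= m.
Proof. by move=> h; rewrite -lee_fin (le_trans (modular_ge0 oph ww x)). Qed.

(** The modular bound is used at [k * x] with the Amemiya multiplier [k]: then [1 + m = k * N], and
    [k] cancels. *)
Lemma homogeneous_le_orlicz_norm G eta x (N : R) : homogeneous G -> modular_bounded G eta ->
  lorentz x -> (orlicz_norm phi w x <= N%:E)%E -> 0 <= eta -> 0 <= N -> `|G x| <= eta * N.
Proof.
move=> hG bG lx xN e0 N0; case: (amemiya_lorentz x N lx xN) => [x0|[k k0 mk]].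
  have -> : G x = 0 * G x.
    by rewrite -hG //; congr G; apply/funext => i; rewrite x0 mul0r.
  by rewrite mul0r normr0 mulr_ge0.
have := bG _ _ mk; rewrite hG // normrM gtr0_norm // => h.
rewrite -(ler_pM2l k0); apply: le_trans h _.
by have -> : eta * (1 + (k * N - 1)) = k * (eta * N) by ring.
Qed.

Lemma dual_norm_leP G (eta : R) : homogeneous G -> 0 <= eta ->
  (dual_norm phi w G <= eta%:E)%E <-> modular_bounded G eta.
Proof.
move=> hG e0; split => [dG x m xm|bG].
  have m0 := modular_bound_ge0 _ _ xm.
  have c0 : 0 < 1 + m by lra.
  have lx : lorentz x by apply/lorentz_modular/(le_lt_trans xm)/ltry.
  have : (`|G (fun i => (1 + m)^-1 * x i)%R|%:E <= eta%:E)%E.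
    apply: le_trans dG; apply: ereal_sup_ubound; exists (fun i => (1 + m)^-1 * x i); last by [].
    by split; [exact: lorentzZ|exact: orlicz_norm_scale_le].
  by rewrite hG // normrM gtr0_norm ?invr_gt0 // lee_fin mulrC ler_pdivrMr.
apply: ge_ereal_sup => _ [x [lx xN] <-]; rewrite lee_fin -[eta]mulr1.
exact: homogeneous_le_orlicz_norm.
Qed.

Lemma homogeneous_orlicz_bound G eta x : homogeneous G -> modular_bounded G eta -> 0 < eta ->
  lorentz x -> (`|G x|%:E <= eta%:E * orlicz_norm phi w x)%E.
Proof.
move=> hG bG e0 lx; have N0 := (orlicz_norm_ge0 nphi (w := w) x).
case E : (orlicz_norm phi w x) N0 => [N||] // N0.
  have N0' : 0 <= N by rewrite -lee_fin.
  have xN : (orlicz_norm phi w x <= N%:E)%E by rewrite E.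
  by rewrite -EFinM lee_fin (homogeneous_le_orlicz_norm G eta x N hG bG lx xN (ltW e0) N0').
by rewrite gt0_muley ?leey // lte_fin.
Qed.

Lemma bounded_functional_modular F : bounded_functional phi w F ->
  exists2 M, 0 < M & modular_bounded F M.
Proof.
move=> [_ FZ [M hM]]; exists (`|M| + 1); first by rewrite ltr_wpDl.
apply/dual_norm_leP; [exact: FZ|by rewrite addr_ge0|].
apply: ge_ereal_sup => _ [x [lx xN] <-]; apply: le_trans (hM x lx) _.
apply: (@le_trans _ _ ((`|M| + 1)%:E * orlicz_norm phi w x)%E).
  apply: lee_wpmul2r; first exact: (orlicz_norm_ge0 nphi (w := w) x).
  by rewrite lee_fin; have := ler_norm M; lra.
by rewrite -[leRHS]mule1; apply: lee_wpmul2l => //; rewrite lee_fin addr_ge0.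
Qed.

Lemma dual_norm_ge0 G : (0 <= dual_norm phi w G)%E.
Proof.
have l0 : lorentz (fun=> 0) by apply: (lorentz_finsupp _ 0).
apply: (@le_trans _ _ `|G (fun=> 0)|%:E); first by rewrite lee_fin.
apply: ereal_sup_ubound; exists (fun=> 0); last by [].
split; first exact: l0.
have := orlicz_norm_scale_le nphi ww (fun=> 0) 0.
have -> : (fun i : nat => (1 + 0)^-1 * (0 : R)) = (fun=> 0) by apply/funext => i; rewrite mulr0.
apply; apply: (modular_le oph ww) => s us; rewrite lee_fin /arrangement_sum big1 // => i _.
by rewrite normr0 (orlicz_0 oph) mul0r.
Qed.

(** In the unit ball the Amemiya multiplier satisfies [k * 1 - 1 >= 0], so [k >= 1] and the modular
    of [k * x] dominates that of [x]. *)
Lemma orlicz_ball_modular x : lorentz x -> (orlicz_norm phi w x <= 1)%E -> (modular x < +oo)%E.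
Proof.
move=> lx xN; case: (amemiya_lorentz x 1 lx xN) => [x0|[k k0 mk]].
  by apply: (modular_finsupp oph ww _ 0) => i _; rewrite x0.
have := modular_bound_ge0 _ _ mk; rewrite mulr1 => k1.
apply: (@le_lt_trans _ _ (k * 1 - 1)%:E); last exact: ltry.
apply: le_trans mk; apply: (le_modular oph ww) => i; rewrite normrM ler_peMl // gtr0_norm //; lra.
Qed.

(** * The splitting of a bounded functional and its norm *)

Section decomposition.
Variable F : (nat -> R) -> R.
Hypothesis bF : bounded_functional phi w F.
Let FD := functionalD bF.
Let FZ : homogeneous F := functionalZ bF.

Definition coef i := F (fun j => if j == i then 1 else 0).
Local Notation y := coef.
Definition regular_part x : R := limn (series (fun i => x i * y i)).
Local Notation H := regular_part.
Definition singular_part x : R := F x - H x.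
Local Notation S := singular_part.

Lemma functional_head n x : F (head_part n x) = \sum_(i < n) x i * y i.
Proof.
elim: n => [|n IH].
  rewrite big_ord0 -(mul0r (F (fun=> 0))) -FZ; last by apply: (lorentz_finsupp _ 0).
  by congr F; apply/funext => i; rewrite /head_part mul0r.
rewrite big_ord_recr /= -IH /coef -FZ; last first.
  by apply: (lorentz_finsupp _ n.+1) => i ni; rewrite gtn_eqF.
rewrite -FD; last 2 first.
- by apply: (lorentz_finsupp _ n) => i ni; rewrite /head_part ltnNge ni.
- apply: lorentzZ; apply: (lorentz_finsupp _ n.+1) => i ni; rewrite gtn_eqF //.
congr F; apply/funext => i; rewrite /head_part ltnS.
by case: (ltngtP i n) => [||->]; rewrite ?mulr0 ?mulr1 ?addr0 ?add0r.
Qed.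

(** Adjusting signs turns the sum of absolute values into a value of [F] on a finitely supported
    sequence without increasing the modular. *)
Lemma abs_sum_coef_le (M : R) x (m : R) n : modular_bounded F M -> (modular x <= m%:E)%E ->
  \sum_(i < n) `|x i * y i| <= M * (1 + m).
Proof.
move=> bM xm; pose x' i := Num.sg (x i * y i) * x i.
have -> : \sum_(i < n) `|x i * y i| = F (head_part n x').
  rewrite functional_head; apply: eq_bigr => i _.
  by rewrite /x' -mulrA normrEsg.
apply: le_trans (ler_norm _) _; apply: bM; apply: le_trans xm.
apply: (le_modular oph ww) => i; rewrite /head_part; case: ifP => _; rewrite ?normr0 //.
by rewrite /x' normrM normr_sg; case: eqP => _; rewrite ?mul0r ?mul1r.
Qed.

Lemma regular_part_cvg x : lorentz x -> series (fun i => x i * y i) @ \oo --> H x.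
Proof.
move=> [e e0 mx]; apply: (@cvgP R) => //.
have [M M0 bM] := bounded_functional_modular F bF.
have mE : (modular (fun i => e * x i)%R <= (fine (modular (fun i => e * x i)%R))%:E)%E.
  by rewrite fineK // ge0_fin_numE // (modular_ge0 oph ww).
apply: normed_cvg; apply: nondecreasing_is_cvgn.
  by apply: nondecreasing_series => i _ _; apply: normr_ge0.
exists (M * (1 + fine (modular (fun i => e * x i)%R)) / e) => _ [n _ <-].
rewrite ler_pdivlMr //; apply: le_trans (abs_sum_coef_le M _ _ n bM mE).
rewrite /normed_series_of seriesEord /= mulr_suml; apply: ler_sum => i _.
by rewrite -mulrA [leRHS]normrM (gtr0_norm e0) mulrC.
Qed.

Lemma regular_part_eq x l : series (fun i => x i * y i) @ \oo --> l -> H x = l.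
Proof. by move=> /cvg_lim; apply. Qed.

Lemma regular_part_head n x : H (head_part n x) = \sum_(i < n) x i * y i.
Proof.
apply: regular_part_eq; apply: cvg_near_cst; exists n => // m /= nm.
rewrite seriesEord /=.
rewrite (big_ord_widen _ (fun i => x i * y i) nm) [RHS]big_mkcond /=.
by apply: eq_bigr => i _; rewrite /head_part; case: ifP => // _; rewrite mul0r.
Qed.

Lemma regular_partD x z : lorentz x -> lorentz z -> H (fun i => x i + z i) = H x + H z.
Proof.
move=> lx lz; apply: regular_part_eq.
have -> : series (fun i => (x i + z i) * y i) =
    (fun n => series (fun i => x i * y i) n + series (fun i => z i * y i) n).
  apply/funext => n; rewrite !seriesEord /= -big_split /=.
  by apply: eq_bigr => i _; rewrite mulrDl.
exact: (cvgD (regular_part_cvg x lx) (regular_part_cvg z lz)).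
Qed.

Lemma regular_partZ : homogeneous H.
Proof.
move=> a x lx; apply: regular_part_eq.
have -> : series (fun i => (a * x i) * y i) = (fun n => a * series (fun i => x i * y i) n).
  apply/funext => n; rewrite !seriesEord /= mulr_sumr.
  by apply: eq_bigr => i _; rewrite mulrA.
exact: (cvgMl_tmp (regular_part_cvg x lx)).
Qed.

Lemma regular_part_le x (b : R) : lorentz x ->
  (forall n, \sum_(i < n) `|x i * y i| <= b) -> `|H x| <= b.
Proof.
move=> lx hb.
have hn : \forall n \near \oo, `|series (fun i => x i * y i) n| <= b.
  by apply: nearW => n; apply: le_trans (hb n); rewrite seriesEord; apply: ler_norm_sum.
exact: (closed_cvg (fun t : R => t <= b) (@closed_le R b) hn _ (cvg_norm (regular_part_cvg x lx))).
Qed.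

Lemma modular_bounded_regular_part (M : R) : modular_bounded F M -> modular_bounded H M.
Proof.
move=> bM x m xm; apply: regular_part_le; last by move=> n; apply: abs_sum_coef_le.
by apply/lorentz_modular/(le_lt_trans xm)/ltry.
Qed.

Lemma modular_bounded_functional G (M : R) : 0 < M ->
  (forall x z, lorentz x -> lorentz z -> G (fun i => x i + z i) = G x + G z) ->
  homogeneous G -> modular_bounded G M -> bounded_functional phi w G.
Proof.
move=> M0 GD GZ bG; split => //; exists M => x lx.
exact: homogeneous_orlicz_bound.
Qed.

Lemma bounded_regular_part : bounded_functional phi w H.
Proof.
have [M M0 bM] := bounded_functional_modular F bF.
apply: (modular_bounded_functional _ M) => //.
- exact: regular_partD.
- exact: regular_partZ.
- exact: modular_bounded_regular_part.
Qed.

Lemma singular_partZ : homogeneous S.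
Proof. by move=> a x lx; rewrite /singular_part FZ // regular_partZ // mulrBr. Qed.

Lemma singular_partD x z : lorentz x -> lorentz z -> S (fun i => x i + z i) = S x + S z.
Proof. by move=> lx lz; rewrite /singular_part FD // regular_partD //; ring. Qed.

Lemma bounded_singular_part : bounded_functional phi w S.
Proof.
have [M M0 bM] := bounded_functional_modular F bF.
apply: (modular_bounded_functional _ (2 * M)); [by rewrite mulr_gt0| | |].
- exact: singular_partD.
- exact: singular_partZ.
- move=> x m xm; apply: le_trans (ler_normB _ _) _.
  have := bM _ _ xm; have := modular_bounded_regular_part M bM _ _ xm; lra.
Qed.

Lemma singular_part_head n x : S (head_part n x) = 0.
Proof. by rewrite /singular_part functional_head regular_part_head subrr. Qed.

Lemma head_tail n x : (fun i => head_part n x i + tail_part n x i) = x.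
Proof. by apply/funext => i; rewrite /head_part /tail_part; case: ifP; rewrite ?addr0 ?add0r. Qed.

Lemma lorentz_head n x : lorentz (head_part n x).
Proof. by apply: (lorentz_finsupp _ n) => i ni; rewrite /head_part ltnNge ni. Qed.

Lemma lorentz_tail n x : lorentz x -> lorentz (tail_part n x).
Proof. by apply: lorentz_le => i; rewrite /tail_part; case: ifP; rewrite ?normr0. Qed.

Lemma functional_tail n x : lorentz x ->
  F (tail_part n x) = F x - series (fun i => x i * y i) n.
Proof.
move=> lx; rewrite -{2}(head_tail n x) FD; [|exact: lorentz_head|exact: lorentz_tail].
by rewrite functional_head seriesEord /= addrC addKr.
Qed.

Lemma singular_part_tail n x : lorentz x -> S (tail_part n x) = S x.
Proof.
move=> lx; rewrite -{2}(head_tail n x) singular_partD; [|exact: lorentz_head|exact: lorentz_tail].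
by rewrite singular_part_head add0r.
Qed.

(** Order continuity makes the Luxemburg norms of the tails of [|x|] tend to 0, while [S] takes the
    same value on every tail of [x]. *)
Lemma singular_singular_part : singular_functional phi w S.
Proof.
split; first exact: bounded_singular_part.
move=> x [lx ocx]; have [M M0 bM] := bounded_functional_modular S bounded_singular_part.
have [||| _ ux] := ocx (fun n => tail_part n (fun i => `|x i|)).
- by move=> n i; rewrite /tail_part; case: ifP; rewrite ?lexx normr_ge0.
- move=> i m n mn; rewrite /tail_part; case: (ltnP i n) => [_|ni]; first by case: ifP.
  by rewrite ltnNge (leq_trans mn ni).
- move=> i; apply: cvg_near_cst; exists i.+1 => // n /= iN.
  by rewrite /tail_part iN.
apply/eqP; rewrite -normr_le0; apply/ler_addgt0Pr => e e0; rewrite add0r.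
(* A tail scaled by [eps^-1] has modular at most 1, so [|S x| <= eps * M * (1 + 1)]. *)
have d0 : (0 < (e / (2 * M))%:E)%E by rewrite lte_fin divr_gt0 // mulr_gt0.
have [n _ hn] : \forall n \near \oo,
    (luxemburg_norm phi w (tail_part n (fun i => `|x i|%R)) < (e / (2 * M))%:E)%E.
  exact: (ux _ (open_ereal_lt' d0)).
have [_ [eps [eps0 me] <-]] := ereal_inf_lt (hn n (leqnn n)); rewrite lte_fin => epslt.
have mt : (modular (fun i => eps^-1 * tail_part n x i)%R <= 1%:E)%E.
  apply: le_trans me; apply: (le_modular oph ww) => i.
  by rewrite /tail_part mulrC; case: ifP; rewrite ?mul0r // !normrM normr_id.
have := bM _ _ mt; rewrite singular_partZ; last exact: lorentz_tail.
rewrite singular_part_tail // normrM gtr0_norm ?invr_gt0 // mulrC ler_pdivrMr // => /le_trans; apply.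
have : eps * (2 * M) <= e by rewrite -ler_pdivlMr ?mulr_gt0 // ltW.
lra.
Qed.

(** The norm of [S] only gives [s * (1 + m)]. Passing to tails, which leaves [S x] unchanged, makes
    [m] arbitrarily small. *)
Lemma singular_part_modular_le x (s : R) : (dual_norm phi w S <= s%:E)%E -> (modular x < +oo)%E ->
  `|S x| <= s.
Proof.
move=> Ss mx; have s0 : 0 <= s by rewrite -lee_fin (le_trans (dual_norm_ge0 S)).
have bS := (dual_norm_leP S s singular_partZ s0).1 Ss.
apply/ler_addgt0Pr => e e0.
have e1 : 0 < e / (s + 1) by rewrite divr_gt0 // ltr_wpDl.
have [N hN] := modular_tail_cvg0 oph ww x _ mx e1.
have := bS _ _ (hN N (leqnn N)); rewrite singular_part_tail; last exact: lorentz_modular.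
have : e / (s + 1) * (s + 1) = e by rewrite divfK // gt_eqF // ltr_wpDl.
have := ltW e1; nra.
Qed.

(** The signs of [y] are absorbed into [u], so that [p_modular_le] applies to [y / eta]. *)
Lemma p_modular_coef_le (eta D : R) : 0 < eta ->
  (forall u n (m : R), (forall i, (n <= i)%N -> u i = 0) -> (modular u <= m%:E)%E ->
     \sum_(i < n) u i * y i <= eta * (D + m)) ->
  (p_modular psi w (fun i => y i / eta)%R <= D%:E)%E.
Proof.
move=> eta0 hD; apply: (p_modular_le nphi ww) => -[n u] [/= u0 un].
have mu := modular_finsupp oph ww u n un.
rewrite -[Defs.modular phi w u]fineK; last by rewrite ge0_fin_numE // (modular_ge0 oph ww).
rewrite -EFinD lee_fin.
have := hD (fun i => Num.sg (y i) * u i) n (fine (modular u)) => h.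
rewrite -(ler_pM2l eta0); apply: le_trans (h _ _); last 2 first.
- by move=> i /un ->; rewrite mulr0.
- rewrite fineK; last by rewrite ge0_fin_numE // (modular_ge0 oph ww).
  apply: (le_modular oph ww) => i; rewrite normrM normr_sg.
  by case: eqP => _; rewrite ?mul0r ?mul1r.
rewrite mulr_sumr; apply: ler_sum => i _.
rewrite normrM normfV (gtr0_norm eta0) [in leLHS]mulrCA -mulrCA.
have -> : eta * (u i * (`|y i| / eta)) = u i * `|y i| by field; rewrite gt_eqF.
by rewrite mulrAC -normrEsg mulrC.
Qed.

Lemma regular_part_p_modular_le (eta : R) x (m P : R) : 0 < eta -> (modular x <= m%:E)%E ->
  (p_modular psi w (fun i => y i / eta)%R <= P%:E)%E -> `|H x| <= eta * (m + P).
Proof.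
move=> eta0 xm hP; have mx : (modular x < +oo)%E by apply: le_lt_trans xm _; apply: ltry.
apply: regular_part_le; first exact: lorentz_modular.
move=> n; have := p_modular_ub nphi ww x (fun i => y i / eta) n mx.
move=> /le_trans /(_ (leeD xm hP)); rewrite -EFinD lee_fin => h.
rewrite -ler_pdivrMl //; apply: le_trans h; rewrite mulr_sumr; apply: ler_sum => i _.
by rewrite mulrA [leRHS]normrM normfV (gtr0_norm eta0) mulrC.
Qed.

Lemma dual_norm_regular_partP (eta : R) : 0 < eta ->
  (dual_norm phi w H <= eta%:E)%E <-> (p_modular psi w (fun i => y i / eta)%R <= 1)%E.
Proof.
move=> eta0; rewrite (dual_norm_leP _ _ regular_partZ (ltW eta0)); split => [bH|hp x m xm].
  apply: p_modular_coef_le => // u n m un um.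
  have -> : \sum_(i < n) u i * y i = H u.
    rewrite -regular_part_head; congr H; apply/funext => i; rewrite /head_part.
    by case: ltnP => // /un.
  exact: le_trans (ler_norm _) (bH _ _ um).
by rewrite addrC; apply: regular_part_p_modular_le.
Qed.

(** Test [F] on [u] plus a far tail of [z]: the supports are disjoint, the tail adds almost nothing
    to the modular, and [F] on the tail approaches [S z]. *)
Lemma disjoint_bound (eta : R) u n (m : R) z : 0 < eta -> modular_bounded F eta ->
  (forall i, (n <= i)%N -> u i = 0) -> (modular u <= m%:E)%E -> (modular z < +oo)%E ->
  \sum_(i < n) u i * y i + S z <= eta * (1 + m).
Proof.
move=> eta0 bF' un um mz; apply/ler_addgt0Pr => e e0.
have lz : lorentz z by apply: lorentz_modular.
have e1 : 0 < e / (eta + 1) by rewrite divr_gt0 // addr_gt0.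
(* The modular of the tail costs [eta * d] and the remainder of the series costs [d], together
   [e]. *)
set d := e / (eta + 1) in e1.
have [N1 hN1] := modular_tail_cvg0 oph ww z d mz e1.
have [N2 _ hN2] : \forall n \near \oo, `|H z - series (fun i => z i * y i) n| < d.
  by move: (regular_part_cvg z lz) => /cvgrPdist_lt /(_ d e1).
pose N := maxn n (maxn N1 N2).
have nN : (n <= N)%N by rewrite leq_maxl.
have h1 : (modular (tail_part N z) <= d%:E)%E by apply: hN1; rewrite !leq_max leqnn orbT.
have h2 : `|H z - series (fun i => z i * y i) N| < d by apply: hN2; rewrite /= !leq_max leqnn !orbT.
have md : (modular (fun i => u i + tail_part N z i)%R <= (m + d)%:E)%E.
  apply: le_trans (modular_disjoint oph ww _ _ _) _; last by rewrite EFinD leeD.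
  move=> i; rewrite /tail_part; case: (ltnP i N) => iN; [by right|left].
  by apply: un; apply: leq_trans iN.
have := le_trans (ler_norm _) (bF' _ _ md).
rewrite FD; [|exact: (lorentz_finsupp _ n)|exact: lorentz_tail].
rewrite functional_tail //.
have -> : F u = \sum_(i < n) u i * y i.
  rewrite -functional_head; congr F; apply/funext => i; rewrite /head_part.
  by case: ltnP => // /un.
have dE : d * (eta + 1) = e by rewrite /d divfK // gt_eqF // addr_gt0.
move: h2; rewrite ltr_norml => /andP[h2 h3].
by rewrite /singular_part; nra.
Qed.

(** Forward: the disjoint test bounds the [p] term by [1 - S z / eta] for every [z] of finite
    modular, and the supremum over the unit ball brings in the norm of [S]. Backward: [|H x|] is at
    most [eta * (m + P)] and [|S x|] at most [s], which add up to at most [eta * (1 + m)]. *)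
Lemma dual_norm_functionalP (eta : R) : 0 < eta ->
  (dual_norm phi w F <= eta%:E)%E <->
  (p_modular psi w (fun i => y i / eta)%R + (eta^-1)%:E * dual_norm phi w S <= 1)%E.
Proof.
move=> eta0; rewrite (dual_norm_leP _ _ FZ (ltW eta0)).
have p0 := p_modular_ge0 nphi (w := w) (fun i => y i / eta).
have S0 := dual_norm_ge0 S.
have ei0 : 0 < eta^-1 by rewrite invr_gt0.
split => [bF'|].
  have pz z : (modular z < +oo)%E ->
      (p_modular psi w (fun i => y i / eta)%R <= (1 - S z / eta)%:E)%E.
    move=> mz; apply: p_modular_coef_le => // u n m un um.
    have := disjoint_bound eta u n m z eta0 bF' un um mz.
    have -> : eta * (1 - S z / eta + m) = eta * (1 + m) - S z by field; rewrite gt_eqF.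
    lra.
  have pf : p_modular psi w (fun i => y i / eta)%R \is a fin_num.
    rewrite ge0_fin_numE //; apply: le_lt_trans (pz (fun=> 0) _) _; last exact: ltry.
    exact: (modular_finsupp oph ww _ 0).
  set P := fine (p_modular psi w (fun i => y i / eta)%R).
  have PE : p_modular psi w (fun i => y i / eta)%R = P%:E by rewrite /P fineK.
  have SP : (dual_norm phi w S <= (eta * (1 - P))%:E)%E.
    apply: ge_ereal_sup => _ [z [lz zN] <-]; rewrite lee_fin.
    have mz := orlicz_ball_modular z lz zN.
    (* Using [- z] as well as [z] gives the bound for the absolute value of [S z]. *)
    have mz' : (modular (fun i => (-1) * z i)%R < +oo)%E.
      apply: le_lt_trans mz; apply: (le_modular oph ww) => i.
      by rewrite mulN1r normrN.
    have := pz _ mz; have := pz _ mz'; rewrite singular_partZ // PE !lee_fin.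
    rewrite mulN1r mulNr opprK => h1 h2.
    have zE : S z / eta * eta = S z by rewrite divfK // gt_eqF.
    by rewrite ler_norml; apply/andP; split; nra.
  rewrite PE; apply: (@le_trans _ _ (P%:E + (eta^-1)%:E * (eta * (1 - P))%:E)%E).
    by rewrite leeD2l // lee_wpmul2l // lee_fin ltW.
  by rewrite -EFinM -EFinD lee_fin mulKf ?gt_eqF // addrC subrK.
move=> hp x m xm.
have Sf : dual_norm phi w S \is a fin_num.
  rewrite ge0_fin_numE // ltNge leye_eq; apply/negP => /eqP SE; move: hp.
  by rewrite SE gt0_muley ?lte_fin // addey ?leye_eq // gt_eqF // (lt_le_trans _ p0).
have SE := fineK Sf; set s := fine _ in SE.
have pf : p_modular psi w (fun i => y i / eta)%R \is a fin_num.
  rewrite ge0_fin_numE //; apply: (@le_lt_trans _ _ 1%E); last exact: ltry.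
  by apply: le_trans hp; rewrite leeDl // mule_ge0 // lee_fin ltW.
have PE := fineK pf; set P := fine _ in PE.
move: hp; rewrite -SE -PE -EFinM -EFinD lee_fin => hp.
have mx : (modular x < +oo)%E by apply: le_lt_trans xm _; apply: ltry.
have hH : `|H x| <= eta * (m + P) by apply: regular_part_p_modular_le; rewrite // PE.
have hS : `|S x| <= s by apply: singular_part_modular_le; rewrite // SE.
have -> : F x = H x + S x by rewrite /singular_part addrC subrK.
apply: le_trans (ler_normD _ _) _.
have sE : eta * (eta^-1 * s) = s by rewrite mulVKf // gt_eqF.
have := ler_wpM2l (ltW eta0) hp; lra.
Qed.

Lemma coef_m_space : m_space psi w y.
Proof.
have [M M0 bM] := bounded_functional_modular F bF.
exists M^-1; first by rewrite invr_gt0.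
have -> : (fun i => M^-1 * y i) = (fun i => y i / M) by apply/funext => i; rewrite mulrC.
apply: (@le_lt_trans _ _ 1%E); last exact: ltry.
apply/dual_norm_regular_partP => //; apply/dual_norm_leP; [exact: regular_partZ|exact: ltW|].
exact: modular_bounded_regular_part.
Qed.

End decomposition.
End dual_norms.

Theorem theorem3p7 (R : realType) (phi : R -> R) (w : nat -> R)
    (F : (nat -> R) -> R) :
  N_function phi -> weight_sequence w -> bounded_functional phi w F ->
  exists (H S : (nat -> R) -> R) (y : nat -> R),
    (forall x, orlicz_lorentz phi w x -> F x = H x + S x) /\
    bounded_functional phi w H /\
    m_space (complementary phi) w y /\
    (forall x, orlicz_lorentz phi w x ->
       series (fun i => x i * y i) @ \oo --> H x) /\
    dual_norm phi w H = m_norm (complementary phi) w y /\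
    singular_functional phi w S /\
    dual_norm phi w F =
      ereal_inf [set eta%:E | eta in [set eta : R | 0 < eta /\
        (p_modular (complementary phi) w (fun i => (y i / eta)%R)
          + (eta^-1)%:E * dual_norm phi w S <= 1)%E]].
Proof.
move=> nphi ww bF; exists (regular_part F), (singular_part F), (coef F).
split; first by move=> x _; rewrite /singular_part addrC subrK.
split; first exact: (bounded_regular_part nphi ww).
split; first exact: (coef_m_space nphi ww F bF).
split; first exact: (regular_part_cvg nphi ww F bF).
split.
  (* Both norms become infima of sets of positive [eta], which agree member by member. *)
  rewrite (ereal_inf_ge_eps _ _ (dual_norm_ge0 nphi ww (regular_part F))) /m_norm.
  congr (ereal_inf (image _ _)); apply/seteqP; split => eta /= [eta0 h]; split => //;
    exact/(dual_norm_regular_partP nphi ww F bF).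
split; first exact: (singular_singular_part nphi ww).
rewrite {1}(ereal_inf_ge_eps _ _ (dual_norm_ge0 nphi ww F)).
congr (ereal_inf (image _ _)); apply/seteqP; split => eta /= [eta0 h]; split => //;
  exact/(dual_norm_functionalP nphi ww F bF).
Qed.
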